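(* Let $y$ be the solution of the delay differential problem $$\dot y(t)=f(y(t),y(t-\tau)),\quad t\in[t_0,T],\qquad y(t_0)=y_0,\qquad y(t)=\phi(t),\quad t\in[t_0-\tau,t_0),$$ with $\tau=\nu h$, $T-t_0=K\tau$, $K,\nu\in\mathbb N$, $t_n=t_0+nh$ for $n=-\nu,\dots,N\equiv K\nu$. Let $s\ge1$ and let $\sigma_n$, $y_n=\sigma_n(h)$ be the piecewise polynomial approximation of degree at most $s$ and grid values defined in the context; let $\hat\sigma_n(ch):=y(t_{n-1}+ch)$ and $\delta\sigma_n(ch):=\hat\sigma_n(ch)-\sigma_n(ch)$. Then, for $n=1,\dots,N\equiv K\nu$, $$y(t_n)-y_n=y(t_{n-1})-y_{n-1}+O(h^{2s+1}),\qquad \|\delta\sigma_n\|:=\max_{c\in[0,1]}|\delta\sigma_n(ch)|=O(h^{s+1}).$$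
   Context: $f:\mathbb R^m\times\mathbb R^m\to\mathbb R^m$ and $\phi:[t_0-\tau,t_0]\to\mathbb R^m$ are assumed suitably regular (as smooth as needed); $\tau>0$ is a constant delay; usually $y_0=\phi(t_0)$; $y$ is the solution on $[t_0,T]$. $|\cdot|$ is any vector norm. $\{P_j\}_{j\ge0}$ is the orthonormal Legendre basis on $[0,1]$: $P_j$ is a polynomial of degree $j$, $\int_0^1P_i(x)P_j(x)\,dx=\delta_{ij}$, $P_0\equiv1$. For functions $z,w:[0,h]\to\mathbb R^m$ set $\gamma_j(z,w):=\int_0^1P_j(\zeta)f(z(\zeta h),w(\zeta h))\,d\zeta$. For $n=1-\nu,\dots,0$ and $c\in[0,1]$: $\hat\sigma_n(ch)=\sigma_n(ch)=\phi(t_{n-1}+ch)$. For $n=1,\dots,N$, $\sigma_n$ is the $\mathbb R^m$-valued polynomial of degree at most $s$ defined successively, starting from $y_0$, by $$\dot\sigma_n(ch)=\sum_{j=0}^{s-1}P_j(c)\gamma_j(\sigma_n,\sigma_{n-\nu}),\quad c\in[0,1],\qquad \sigma_n(0)=y_{n-1},\qquad y_n:=\sigma_n(h)=y_{n-1}+h\gamma_0(\sigma_n,\sigma_{n-\nu})$$ ($h$ being small enough for $\sigma_n$ to be well defined). The $O(\cdot)$ symbols refer to $h=\tau/\nu\to0$ (i.e. $\nu\to\infty$ with $\tau$ and $K$ fixed), with constants uniform in $n$. *)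

(* Defs.v *)
From HB Require Import structures.
From mathcomp Require Import all_boot all_order all_algebra.
From mathcomp Require Import all_classical all_reals all_analysis.
Set Implicit Arguments.
Unset Strict Implicit.
Unset Printing Implicit Defensive.
Import Order.TTheory GRing.Theory Num.Theory.
Import numFieldNormedType.Exports.
Local Open Scope classical_set_scope.
Local Open Scope ring_scope.

(* The topology on ['rV[R]_m] is the one of the library's sup norm; errors are
   measured in an arbitrary norm [N], which is equivalent to it. *)
Definition is_norm (R : realType) (m : nat) (N : 'rV[R]_m -> R) : Prop :=
  [/\ forall x, N x = 0 -> x = 0,
      forall x y, N (x + y) <= N x + N y
    & forall (a : R) x, N (a *: x) = `|a| * N x].

Definition is_max (R : realType) (A : set R) (M : R) : Prop :=
  A M /\ ubound A M.

(* Class C^k on the whole space, by recursion on directional derivatives; this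
   is the usual C^k only because it is applied to finite-dimensional V. *)
Fixpoint Ck (R : realType) (V W : normedModType R) (k : nat) (g : V -> W)
    : Prop :=
  if k is k'.+1 then
    (forall x, differentiable g x) /\ (forall v, Ck k' ('D_v g))
  else continuous g.

(* C^k on a closed interval, including one-sided regularity at the end points:
   restriction of a C^k function on the line. *)
Definition Ck_itv (R : realType) (W : normedModType R) (k : nat) (a b : R)
    (g : R -> W) : Prop :=
  exists2 g' : R -> W, Ck k (g' : R^o -> W) & {in `[a, b], g =1 g'}.

(* At the end points of an interval [A] this is the one-sided derivative. *)
Definition is_derive_within (R : realType) (W : normedModType R) (A : set R)
    (t : R) (g : R -> W) (l : W) : Prop :=
  (u - t)^-1 *: (g u - g t) @[u --> within A t^'] --> l.

(* [phi t0] and [y0] may differ.  The right-hand side of the equation then jumps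
   at [t0 + tau], where in general y has no derivative; this is the only point
   that is exempted, and only in that case. *)
Definition dde_solution (R : realType) (m : nat)
    (f : 'rV[R]_m * 'rV[R]_m -> 'rV[R]_m) (phi : R -> 'rV[R]_m)
    (t0 tau T : R) (y0 : 'rV[R]_m) (y : R -> 'rV[R]_m) : Prop :=
  [/\ {within `[t0, T], continuous y},
      y t0 = y0,
      forall t : R, t0 - tau <= t < t0 -> y t = phi t
    & forall t : R, t0 <= t <= T -> (t = t0 + tau -> phi t0 = y0) ->
        is_derive_within `[t0, T] t y (f (y t, y (t - tau)))].

(* These conditions determine each P_j up to its sign, and the schemes below do
   not depend on the signs. *)
Definition legendre_basis (R : realType) (P : nat -> {poly R}) : Prop :=
  [/\ forall j, size (P j) = j.+1,
      forall i j,
        \int[lebesgue_measure]_(x in `[0, 1]) ((P i).[x] * (P j).[x])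
          = (i == j)%:R
    & P 0%N = 1].

Definition gamma (R : realType) (m : nat)
    (f : 'rV[R]_m * 'rV[R]_m -> 'rV[R]_m) (P : nat -> {poly R}) (h : R)
    (j : nat) (z w : R -> 'rV[R]_m) : 'rV[R]_m :=
  \row_(i < m) \int[lebesgue_measure]_(x in `[0, 1])
    ((P j).[x] * f (z (x * h), w (x * h)) 0 i).

Definition tgrid (R : realType) (t0 h : R) (n : int) : R := t0 + n%:~R * h.

(* The case [n = 0] is separate because [sigma 0 h = phi t0] need not be [y0]. *)
Definition ygrid (R : realType) (m : nat) (y0 : 'rV[R]_m) (h : R)
    (sigma : int -> R -> 'rV[R]_m) (n : int) : 'rV[R]_m :=
  if n == 0 then y0 else sigma n h.

Definition is_vpoly (R : realType) (m s : nat) (g : R -> 'rV[R]_m) : Prop :=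
  exists2 p : 'I_m -> {poly R}, (forall i, (size (p i) <= s.+1)%N)
    & forall x, g x = \row_(i < m) (p i).[x].

(* The identity y_n = y_(n-1) + h gamma_0(sigma_n, sigma_(n-nu)) is the integral
   over [0, h] of the equation for sigma_n. *)
Definition is_scheme (R : realType) (m : nat)
    (f : 'rV[R]_m * 'rV[R]_m -> 'rV[R]_m) (phi : R -> 'rV[R]_m)
    (P : nat -> {poly R}) (s : nat) (t0 h : R) (nu K : nat) (y0 : 'rV[R]_m)
    (sigma : int -> R -> 'rV[R]_m) : Prop :=
  (forall n : int, 1 - nu%:Z <= n <= 0 -> forall c : R, 0 <= c <= 1 ->
     sigma n (c * h) = phi (tgrid t0 h (n - 1) + c * h)) /\
  (forall n : int, 1 <= n <= (K * nu)%N%:Z ->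
     [/\ is_vpoly s (sigma n),
         sigma n 0 = ygrid y0 h sigma (n - 1)
       & forall c : R, 0 <= c <= 1 ->
           is_derive (c * h) 1 (sigma n)
             (\sum_(j < s) (P j).[c]
                *: gamma f P h j (sigma n) (sigma (n - nu%:Z)))]).

(* The step equation is implicit in sigma_n and, for small h, has exactly one
   solution in a ball around y_(n-1) of radius independent of h.  It may also
   have spurious solutions that run off to infinity as h -> 0: for y' = y^2 and
   s = 1, a second one has size of order 1/h.  For small h this condition is
   what makes sigma_n well defined. *)
Definition near_branch (R : realType) (m : nat) (N : 'rV[R]_m -> R) (rho h : R)
    (nu K : nat) (y0 : 'rV[R]_m) (sigma : int -> R -> 'rV[R]_m) : Prop :=
  forall n : int, 1 <= n <= (K * nu)%N%:Z -> forall c : R, 0 <= c <= 1 ->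
    N (sigma n (c * h) - ygrid y0 h sigma (n - 1)) <= rho.

(* Only meant for n >= 1. *)
Definition delta_sigma (R : realType) (m : nat) (y : R -> 'rV[R]_m) (t0 h : R)
    (sigma : int -> R -> 'rV[R]_m) (n : int) (x : R) : 'rV[R]_m :=
  y (tgrid t0 h (n - 1) + x) - sigma n x.

(* Main.v *)
Require Import Defs.
From HB Require Import structures.
From mathcomp Require Import all_boot all_order all_algebra.
From mathcomp Require Import all_classical all_reals all_analysis.
From mathcomp Require Import ring lra zify.
Set Implicit Arguments.
Unset Strict Implicit.
Unset Printing Implicit Defensive.
Import Order.TTheory GRing.Theory Num.Theory.
Import numFieldNormedType.Exports.
Local Open Scope classical_set_scope.
Local Open Scope ring_scope.

(** Let [eta] bound the error at the start of a step, [u] be the error on the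
    step in the variable [x] of [0, 1], [gh] and [g] the right-hand side along
    the exact solution and along the scheme, and [Pi] the projection onto the
    polynomials of degree less than [s].  Then [u' = h (gh - Pi g)], and
    [gh - Pi g = (gh - Pi gh) + Pi (gh - g)].  The first term is [O(h^s)],
    because the solution is smooth between the points [t0 + j tau]
    ([expands_residual]); the second one is bounded by the error and the delayed
    error.  Hence [u = O(eta + h^(s+1))] ([sup_le]).

    For the increment of the error over the step this pointwise bound would only
    give [O(h^(s+2))].  But integrals against polynomials of degree less than [s]
    do not see [Pi], so the increment is [h] times the integral of [gh - g]
    ([increment_moment]), and [gh - g] is, up to squares of the errors, the sum of
    the errors multiplied by smooth functions (the partial derivatives of [f]
    along the solution).  It remains to see that, if [eta] is [O(h^(2s))], so are
    the averages of the error against smooth functions, although the error itself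
    is only [O(h^(s+1))].  This is proved in the graded form: the integral of
    [(1 - x)^l u] is [O(h^(2s-l))] for [l < s].  Multiplication by a smooth factor preserves such bounds, since the
    term of degree [q] in its expansion at the end of the step carries [h^q]
    ([moment_expands]).  Integration by parts expresses the moment of order [l] of
    [u] by [u(0)] and [h] times the moment of order [l + 1] of [gh - g]
    ([moment_step]), so that one can descend from [l = s - 1], where the pointwise
    bound is enough.

    The resulting bound [C h (eta + h^(2s))] of the increment ([step_estimate])
    gives, by a discrete Gronwall inequality, a grid error [O(h^(2s))] over a whole
    delay interval ([block_boundsS]).  The delayed errors of one delay interval are
    the errors of the preceding one, and there is no error on the history: the
    theorem follows by induction on the [K] delay intervals.

    The smoothness of the solution used above is the existence of polynomial expansions on short
    intervals, with uniform constants ([taylor]).  This class of functions is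
    stable under products and primitives, so it is obtained for all functions
    [g(y(t), y(t - tau))] directly from the equation, one order at a time
    ([taylor_ode]); no higher derivative of the solution is ever formed. *)

(** * Continuous functions on the unit interval *)

Section ContinuousUnitInterval.
Variable R : realType.
Implicit Types (u v : R -> R) (p : {poly R}).

Definition c01 u := {within `[0, 1], continuous u}.

Lemma c01D u v : c01 u -> c01 v -> c01 (fun x => u x + v x).
Proof. by move=> cu cv x; apply: continuousD; [exact: cu|exact: cv]. Qed.

Lemma c01B u v : c01 u -> c01 v -> c01 (fun x => u x - v x).
Proof. by move=> cu cv x; apply: continuousB; [exact: cu|exact: cv]. Qed.

Lemma c01M u v : c01 u -> c01 v -> c01 (fun x => u x * v x).
Proof. by move=> cu cv x; apply: continuousM; [exact: cu|exact: cv]. Qed.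

Lemma c01_continuous u : continuous u -> c01 u.
Proof. by move=> cu; apply: continuous_subspaceT. Qed.

Lemma c01_cst a : c01 (fun=> a).
Proof. by apply: c01_continuous => x; exact: cvg_cst. Qed.

Lemma c01Z a u : c01 u -> c01 (fun x => a * u x).
Proof. by move=> cu; apply: c01M => //; exact: c01_cst. Qed.

Lemma c01_sum (I : finType) (u : I -> R -> R) :
  (forall i, c01 (u i)) -> c01 (fun x => \sum_i u i x).
Proof.
move=> cu; suff: forall r : seq I, c01 (fun x => \sum_(i <- r) u i x) by apply.
elim=> [|i r IH].
  by under eq_fun do rewrite big_nil; exact: c01_cst.
by under eq_fun do rewrite big_cons; apply: c01D.
Qed.

Lemma c01_poly p : c01 (fun x => p.[x]).
Proof. by apply: c01_continuous; exact: continuous_horner. Qed.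

Lemma c01_onemX n : c01 (fun x => (1 - x) ^+ n).
Proof.
have -> : (fun x : R => (1 - x) ^+ n) = (fun x => ((1 - 'X) ^+ n : {poly R}).[x]).
  by apply/funext => x; rewrite !hornerE.
exact: c01_poly.
Qed.

End ContinuousUnitInterval.
Arguments c01D {R u v} _ _.
Arguments c01B {R u v} _ _.
Arguments c01M {R u v} _ _.
Arguments c01_continuous {R u} _.
Arguments c01_cst {R} a.
Arguments c01Z {R} a {u} _.
Arguments c01_sum {R I u} _.
Arguments c01_poly {R} p.
Arguments c01_onemX {R} n.

(** * Integrals and moments on the unit interval *)

Section UnitInterval.
Variable R : realType.
Implicit Types (u v : R -> R).

Definition I01 u : R := \int[lebesgue_measure]_(x in `[0, 1]) u x.

Lemma c01_integrable u : c01 u ->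
  lebesgue_measure.-integrable `[0, 1] (EFin \o u).
Proof.
by move=> cu; apply: continuous_compact_integrable => //; exact: segment_compact.
Qed.

Lemma I01_ext u v : (forall x : R, 0 <= x <= 1 -> u x = v x) -> I01 u = I01 v.
Proof.
move=> uv; apply: eq_Rintegral => x; rewrite inE /= in_itv /=; exact: uv.
Qed.

Lemma I01D u v : c01 u -> c01 v -> I01 (fun x => u x + v x) = I01 u + I01 v.
Proof. by move=> cu cv; rewrite /I01 RintegralD //; exact: c01_integrable. Qed.

Lemma I01B u v : c01 u -> c01 v -> I01 (fun x => u x - v x) = I01 u - I01 v.
Proof. by move=> cu cv; rewrite /I01 RintegralB //; exact: c01_integrable. Qed.

Lemma I01Z a u : c01 u -> I01 (fun x => a * u x) = a * I01 u.
Proof. by move=> cu; rewrite /I01 RintegralZl //; exact: c01_integrable. Qed.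

Lemma I01_cst a : I01 (fun=> a) = a.
Proof.
rewrite /I01 Rintegral_cst //= lebesgue_measure_itv /= lte01 sube0.
by rewrite mulr1.
Qed.

Lemma I01_sum (I : finType) (u : I -> R -> R) :
  (forall i, c01 (u i)) -> I01 (fun x => \sum_i u i x) = \sum_i I01 (u i).
Proof.
move=> cu.
suff: forall r : seq I, c01 (fun x => \sum_(i <- r) u i x) /\
   I01 (fun x => \sum_(i <- r) u i x) = \sum_(i <- r) I01 (u i).
  by move=> /(_ (index_enum I)) [].
elim=> [|i r [IHc IH]].
  rewrite big_nil; under eq_fun do rewrite big_nil.
  by split; [exact: c01_cst | rewrite I01_cst].
rewrite big_cons; under eq_fun do rewrite big_cons.
by split; [exact: c01D | rewrite I01D // IH].
Qed.

Lemma I01_le u M : c01 u -> (forall x : R, 0 <= x <= 1 -> `|u x| <= M) ->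
  `|I01 u| <= M.
Proof.
move=> cu uM; apply: le_trans (le_normr_Rintegral _ (c01_integrable cu)) _ => //.
rewrite -[leRHS]I01_cst; apply: le_Rintegral => //.
- apply: (@c01_integrable (fun x => `|u x|)) => x.
  by apply: continuous_comp; [exact: cu | exact: norm_continuous].
- by apply: c01_integrable; exact: c01_cst.
Qed.

(** Differentiability is asked in the open interval only, since the solution is in
    general not differentiable at the multiples of the delay. *)
Lemma I01_FTC (F f : R -> R) : c01 f -> c01 F ->
  (forall x : R, 0 < x < 1 -> is_derive x 1 F (f x)) -> I01 f = F 1 - F 0.
Proof.
move=> cf cF dF; rewrite /I01 /Rintegral (@continuous_FTC2 _ f F) //.
- have [] := (continuous_within_itvP F (@ltr01 R)).1 cF.
  move=> _ F0 F1; split=> // x; rewrite in_itv /= => /dF h.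
  exact: ex_derive.
- move=> x; rewrite in_itv /= => /dF h; rewrite derive1E.
  exact: derive_val.
Qed.

(** The weights vanish at the right end: the boundary term of an integration by
    parts is then the value at 0, which on a step is the error already made, and
    not the error at 1 that is to be estimated. *)
Definition moment l u := I01 (fun x => (1 - x) ^+ l * u x).

Lemma moment_le l u M : c01 u -> (forall x : R, 0 <= x <= 1 -> `|u x| <= M) ->
  `|moment l u| <= M.
Proof.
move=> cu uM; apply: I01_le; first by apply: c01M => //; exact: c01_onemX.
move=> x x01; have := uM _ x01; apply: le_trans.
rewrite normrM ler_piMl // normrX exprn_ile1 //.
by case/andP: x01 => x0 x1; rewrite ger0_norm; lra.
Qed.

(** The function [- (1 - x)^(l+1) u] has derivative
    [(l+1) (1 - x)^l u - (1 - x)^(l+1) u'] and vanishes at 1. *)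
Lemma moment_primitive l u u' : c01 u -> c01 u' ->
  (forall x : R, 0 < x < 1 -> is_derive x 1 u (u' x)) ->
  l.+1%:R * moment l u = u 0 + moment l.+1 u'.
Proof.
move=> cu cu' du.
have c1 : c01 (fun x => (1 - x) ^+ l * u x) by apply: c01M => //; exact: c01_onemX.
have c2 : c01 (fun x => (1 - x) ^+ l.+1 * u' x).
  by apply: c01M => //; exact: c01_onemX.
rewrite /moment -I01Z //; apply/eqP; rewrite -subr_eq -I01B //; last exact: c01Z.
pose p : {poly R} := - (1 - 'X) ^+ l.+1.
have pE (x : R) : p.[x] = - (1 - x) ^+ l.+1 by rewrite !hornerE.
have FE : (fun x => - ((1 - x) ^+ l.+1 * u x)) = horner p * u.
  by apply/funext => x; rewrite fctE pE mulNr.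
have dF (x : R) : 0 < x < 1 -> is_derive x 1 (fun x => - ((1 - x) ^+ l.+1 * u x))
    (l.+1%:R * ((1 - x) ^+ l * u x) - (1 - x) ^+ l.+1 * u' x).
  move=> x01; rewrite FE; have dpu := is_deriveM (is_derive_poly p x) (du _ x01).
  apply: DeriveDef; first exact: (@ex_derive _ _ _ _ _ _ _ dpu).
  have dpE : p^`().[x] = l.+1%:R * (1 - x) ^+ l.
    rewrite /p derivN deriv_exp derivB derivX derivC sub0r mulN1r mulNrn opprK.
    by rewrite hornerMn !hornerE mulr_natl.
  rewrite (@derive_val _ _ _ _ _ _ _ dpu) pE dpE.
  by rewrite -[_ *: u' x]/(_ * _) -[u x *: _]/(_ * _); ring.
have cF : c01 (fun x => - ((1 - x) ^+ l.+1 * u x)).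
  under eq_fun do rewrite -mulN1r; apply: c01Z; apply: c01M => //.
  exact: c01_onemX.
rewrite (I01_FTC (c01B (c01Z _ c1) c2) cF dF).
by rewrite subr0 subrr expr0n expr1n !mul0r mul1r oppr0 opprK add0r.
Qed.

End UnitInterval.

(** * The Legendre projection *)

Section Legendre.
Variables (R : realType) (P : nat -> {poly R}).
Hypothesis LP : legendre_basis P.
Implicit Types (u v : R -> R) (p : {poly R}).

(** As [P n] has degree exactly [n], a multiple of it cancels the coefficient of
    degree [n]. *)
Lemma legendre_span n p : (size p <= n)%N ->
  exists a : 'I_n -> R, p = \sum_(j < n) a j *: P j.
Proof.
have [sP _ _] := LP; elim: n p => [|n IH] p sp.
  by exists (fun=> 0); rewrite big_ord0; apply/eqP; rewrite -size_poly_leq0.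
have lP : (P n)`_n != 0.
  by have := lead_coef_eq0 (P n); rewrite lead_coefE -size_poly_eq0 sP /= => ->.
pose q := p - (p`_n / (P n)`_n) *: P n.
have /IH[a qa] : (size q <= n)%N.
  apply/leq_sizeP => j; rewrite leq_eqVlt coefB coefZ => /predU1P[<-|nj].
    by rewrite divfK // subrr.
  have -> : p`_j = 0 by apply: (leq_sizeP _ _ sp).
  have -> : (P n)`_j = 0 by apply: (leq_sizeP _ n.+1) => //; rewrite sP.
  by rewrite mulr0 subrr.
exists (fun j : 'I_n.+1 => if unlift ord_max j is Some i then a i else p`_n / (P n)`_n).
rewrite big_ord_recr /= unlift_none.
have -> : \sum_(i < n) (if unlift ord_max (widen_ord (leqnSn n) i) is Some i
    then a i else p`_n / (P n)`_n) *: P i = q.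
  rewrite qa; apply: eq_bigr => i _.
  have -> : widen_ord (leqnSn n) i = lift ord_max i.
    by apply: val_inj; rewrite [RHS]lift_max.
  by rewrite liftK.
by rewrite subrK.
Qed.

(** The scheme makes the derivative of each [sigma n] equal to this projection of the
    right-hand side along [sigma]. *)
Definition legendre_proj s u (x : R) : R :=
  \sum_(j < s) (P j).[x] * I01 (fun z => (P j).[z] * u z).

Lemma c01_proj s u : c01 (legendre_proj s u).
Proof.
by apply: c01_sum => j; apply: c01M; [exact: c01_poly | exact: c01_cst].
Qed.

Lemma projB s u v : c01 u -> c01 v ->
  legendre_proj s (fun x => u x - v x) = fun x => legendre_proj s u x - legendre_proj s v x.
Proof.
move=> cu cv; apply/funext => x; rewrite /legendre_proj -sumrB; apply: eq_bigr => j _.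
rewrite -mulrBr -I01B; [|exact: c01M (c01_poly _) _..].
by congr (_ * _); apply: I01_ext => z _; rewrite mulrBr.
Qed.

Lemma I01_legendre i j : I01 (fun x => (P i).[x] * (P j).[x]) = (i == j)%:R.
Proof. by have [_ oP _] := LP; exact: oP. Qed.

Lemma legendre_coef s (a : 'I_s -> R) (i : 'I_s) :
  I01 (fun x => (P i).[x] * (\sum_(j < s) a j *: P j).[x]) = a i.
Proof.
have -> : I01 (fun x => (P i).[x] * (\sum_(j < s) a j *: P j).[x]) =
    I01 (fun x => \sum_(j < s) a j * ((P i).[x] * (P j).[x])).
  apply: I01_ext => x _; rewrite horner_sum mulr_sumr; apply: eq_bigr => j _.
  by rewrite hornerZ mulrCA.
have cc (j : 'I_s) : c01 (fun x => (P i).[x] * (P j).[x]).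
  by apply: c01M; exact: c01_poly.
rewrite I01_sum; last by move=> j; exact: c01Z.
under eq_bigr do rewrite I01Z // I01_legendre.
rewrite (bigD1 i) //= eqxx mulr1 big1 ?addr0 // => j ji.
by rewrite eq_sym val_eqE (negbTE ji) mulr0.
Qed.

Lemma proj_id s p : (size p <= s)%N -> legendre_proj s (horner p) = horner p.
Proof.
move=> /legendre_span[a ->]; apply/funext => x.
rewrite /legendre_proj horner_sum; apply: eq_bigr => i _.
by rewrite legendre_coef hornerZ mulrC.
Qed.

Lemma I01_proj s p u : (size p <= s)%N -> c01 u ->
  I01 (fun x => p.[x] * legendre_proj s u x) = I01 (fun x => p.[x] * u x).
Proof.
move=> /legendre_span[a ->] cu.
have cPu (j : nat) : c01 (fun x => (P j).[x] * u x) by exact: c01M (c01_poly _) _.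
pose b (j : 'I_s) := I01 (fun z => (P j).[z] * u z).
have -> : legendre_proj s u = horner (\sum_(j < s) b j *: P j).
  apply/funext => x; rewrite /legendre_proj horner_sum; apply: eq_bigr => j _.
  by rewrite hornerZ mulrC.
have E v (cv : forall j : 'I_s, c01 (fun x => (P j).[x] * v x)) :
  I01 (fun x => (\sum_(j < s) a j *: P j).[x] * v x) =
  \sum_(j < s) a j * I01 (fun x => (P j).[x] * v x).
  under [RHS]eq_bigr do rewrite -I01Z //.
  rewrite -I01_sum; last by move=> j; exact: c01Z.
  apply: I01_ext => x _; rewrite horner_sum mulr_suml; apply: eq_bigr => j _.
  by rewrite hornerZ mulrA.
rewrite !E //; last by move=> j; apply: c01M; exact: c01_poly.
by apply: eq_bigr => i _; rewrite legendre_coef.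
Qed.

(** The weight is a polynomial of degree [l < s], and the projection is
    orthogonal. *)
Lemma moment_proj s l u : (l < s)%N -> c01 u ->
  moment l (legendre_proj s u) = moment l u.
Proof.
move=> ls cu; pose p : {poly R} := (1 - 'X) ^+ l.
have sp : (size p <= s)%N.
  apply: leq_trans (size_poly_exp_leq _ _) _.
  rewrite -opprB size_polyN size_XsubC /= mul1n; exact: ls.
have E (x : R) : p.[x] = (1 - x) ^+ l by rewrite !hornerE.
rewrite /moment; under eq_fun do rewrite -E.
rewrite I01_proj //; by under eq_fun do rewrite E.
Qed.

(** The L2 projection is also bounded for the sup norm; the sum of the squared sup
    norms of the [P j] serves as the constant. *)
Lemma proj_le s : exists2 C : R, 0 <= C & forall u (M : R), c01 u ->
  (forall x : R, 0 <= x <= 1 -> `|u x| <= M) ->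
  forall x : R, 0 <= x <= 1 -> `|legendre_proj s u x| <= C * M.
Proof.
have pb (p : {poly R}) :
    exists2 B : R, 0 <= B & forall x : R, 0 <= x <= 1 -> `|p.[x]| <= B.
  have cp : c01 (fun x => `|p.[x]|).
    apply: c01_continuous => x; apply: continuous_comp.
      exact: continuous_horner.
    exact: norm_continuous.
  have [c _ ?] := EVT_max (@ler01 R) cp; by exists `|p.[c]|.
have /choice[B HB] (j : nat) : exists B, 0 <= B /\
    forall x : R, 0 <= x <= 1 -> `|(P j).[x]| <= B.
  by have [B ? ?] := pb (P j); exists B.
exists (\sum_(j < s) B j * B j) => [|u M cu uM x x01].
  by apply: sumr_ge0 => j _; have [? _] := HB j; exact: mulr_ge0.
apply: le_trans (ler_norm_sum _ _ _) _; rewrite mulr_suml; apply: ler_sum => j _.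
have [B0 Bj] := HB j.
rewrite normrM -mulrA; apply: ler_pM => //; first exact: Bj.
apply: I01_le; first by apply: c01M => //; exact: c01_poly.
by move=> z z01; rewrite normrM; apply: ler_pM => //; [exact: Bj|exact: uM].
Qed.

End Legendre.

(** * Functions with uniform polynomial expansions *)

Section TaylorClass.
Variable R : realType.
Implicit Types (u v : R -> R) (p q : {poly R}) (k : nat).

Lemma is_derive_affine u (x h c d : R) : is_derive (x + c * h) 1 u d ->
  is_derive c 1 (fun c => u (x + c * h)) (h * d).
Proof.
move=> du; have -> : (fun c => u (x + c * h)) = u \o (cst x + h *: id).
  by apply/funext => z; rewrite /= !fctE /GRing.scale /= mulrC.
have dg : is_derive c 1 (cst x + h *: id) h.
  have := is_deriveD (is_derive_cst x c 1) (is_deriveZ h (is_derive_id c 1)).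
  by rewrite add0r [X in is_derive _ _ _ X](mulr1 h).
have du' : is_derive ((cst x + h *: id : R -> R) c) 1 u d.
  by rewrite !fctE /GRing.scale /= [h * c]mulrC.
by rewrite mulrC; exact: is_derive1_comp.
Qed.

Lemma horner_le p n (C x : R) : (size p <= n)%N -> (forall i, `|p`_i| <= C) ->
  0 <= x <= 1 -> `|p.[x]| <= n%:R * C.
Proof.
move=> sp pC /andP[x0 x1]; rewrite (horner_coef_wide _ sp).
apply: le_trans (ler_norm_sum _ _ _) _.
rewrite mulr_natl -[n in leRHS]card_ord -sumr_const; apply: ler_sum => i _.
rewrite normrM normrX (ger0_norm x0) -[C]mulr1.
by apply: ler_pM; [|exact: exprn_ge0| |exact: exprn_ile1].
Qed.

(** The variable [c] of [0, 1] stands for [t = x + c h].  A bound of the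
    coefficients in powers of [h (1 - c)] is the analogue of a derivative of order [i]
    in [c] of size [O(h^i)]; the expansion is at the end of the step, like the weights of
    [moment]. *)
Definition expands k (h C : R) u := exists p, [/\ (size p <= k)%N,
  forall i, `|p`_i| <= C &
  forall c : R, 0 <= c <= 1 -> `|u c - p.[h * (1 - c)]| <= C * h ^+ k].

(** A uniform form of C^k regularity on an interval, which asks for no derivative at the
    end points. *)
Definition taylor k (a b : R) u := exists2 C : R, 0 <= C &
  forall x h : R, a <= x -> 0 < h <= 1 -> x + h <= b ->
    expands k h C (fun c => u (x + c * h)).

Lemma scaled_itv (h c : R) : 0 < h <= 1 -> 0 <= c <= 1 -> 0 <= h * (1 - c) <= 1.
Proof. by move=> /andP[? ?] /andP[? ?]; apply/andP; split; nra. Qed.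

Lemma expands_le k (h C : R) u : expands k h C u -> 0 < h <= 1 -> 0 <= C ->
  forall c : R, 0 <= c <= 1 -> `|u c| <= (k%:R + 1) * C.
Proof.
move=> [p [sp pC up]] h01 C0 c c01.
have -> : u c = p.[h * (1 - c)] + (u c - p.[h * (1 - c)]) by ring.
apply: le_trans (ler_normD _ _) _; rewrite mulrDl mul1r; apply: lerD.
  by apply: horner_le => //; exact: scaled_itv.
apply: le_trans (up _ c01) _; rewrite -[leRHS]mulr1; apply: ler_wpM2l => //.
by case/andP: h01 => h0 h1; apply: exprn_ile1 => //; exact: ltW.
Qed.

Lemma expandsD k (h C D : R) u v : expands k h C u -> expands k h D v ->
  expands k h (C + D) (fun c => u c + v c).
Proof.
move=> [p [sp pC up]] [q [sq qC vq]]; exists (p + q); split.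
- by rewrite (leq_trans (size_polyD _ _)) // geq_max sp.
- move=> i; rewrite coefD; apply: le_trans (ler_normD _ _) _.
  exact: lerD.
- move=> c c01; rewrite hornerD mulrDl.
  have -> : u c + v c - (p.[h * (1 - c)] + q.[h * (1 - c)]) =
    (u c - p.[h * (1 - c)]) + (v c - q.[h * (1 - c)]) by ring.
  by apply: le_trans (ler_normD _ _) _; apply: lerD; [exact: up|exact: vq].
Qed.

(** The product of the two polynomials is truncated at degree [k]; what is dropped
    has the factor [(h (1 - c))^k]. *)
Lemma expandsM k (h C D : R) u v : 0 < h <= 1 -> 0 <= C -> 0 <= D ->
  expands k h C u -> expands k h D v ->
  expands k h ((k.*2 + 1)%:R ^+ 2 * (C * D)) (fun c => u c * v c).
Proof.
move=> h01 C0 D0 eu ev; have vb := expands_le ev h01 D0.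
move: eu ev => [p [sp pC up]] [q [sq qC vq]].
have CD0 : 0 <= C * D by exact: mulr_ge0.
have spq : (size (p * q)%R <= k.*2)%N.
  apply: leq_trans (size_polyMleq _ _) _; rewrite -addnn.
  by apply: leq_trans (leq_pred _) _; exact: leq_add.
have pqC i : `|(p * q)`_i| <= k.*2%:R * (C * D).
  have [ik|ik] := leqP k.*2 i.
    by rewrite (leq_sizeP _ _ spq) // normr0; exact: mulr_ge0.
  rewrite coefM; apply: le_trans (ler_norm_sum _ _ _) _.
  apply: (@le_trans _ _ (i.+1%:R * (C * D))).
    rewrite mulr_natl -[i.+1 in leRHS]card_ord -sumr_const; apply: ler_sum => j _.
    by rewrite normrM; apply: ler_pM.
  by apply: ler_wpM2r => //; rewrite ler_nat.
have k2E : k.*2%:R = 2 * k%:R :> R by rewrite -muln2 natrM mulrC.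
have K0 : 0 <= k%:R :> R by exact: ler0n.
exists (take_poly k (p * q)); split.
- by rewrite size_take_poly.
- move=> i; rewrite coef_take_poly; case: ifP => _.
    apply: le_trans (pqC i) _; apply: ler_wpM2r => //.
    by rewrite natrD k2E; nra.
  by rewrite normr0 mulr_ge0 // exprn_ge0.
- move=> c c01; set z := h * (1 - c).
  have z01 : 0 <= z <= 1 by exact: scaled_itv.
  have hk0 : 0 <= h ^+ k by case/andP: h01 => h0 _; apply/exprn_ge0/ltW.
  have E : (p * q).[z] = (take_poly k (p * q)).[z] + (drop_poly k (p * q)).[z] * z ^+ k.
    by rewrite -{1}(poly_take_drop k (p * q)) hornerD hornerM hornerXn.
  have -> : u c * v c - (take_poly k (p * q)).[z] =
     (u c - p.[z]) * v c + p.[z] * (v c - q.[z]) + (drop_poly k (p * q)).[z] * z ^+ k.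
    by move: E; rewrite hornerM => E; rewrite -[X in _ + X]addr0; nra.
  have b1 : `|(u c - p.[z]) * v c| <= (C * h ^+ k) * ((k%:R + 1) * D).
    by rewrite normrM; apply: ler_pM => //; [exact: up|exact: vb].
  have b2 : `|p.[z] * (v c - q.[z])| <= (k%:R * C) * (D * h ^+ k).
    by rewrite normrM; apply: ler_pM => //; [exact: horner_le|exact: vq].
  have b3 : `|(drop_poly k (p * q)).[z] * z ^+ k| <=
      (k.*2%:R * (k.*2%:R * (C * D))) * h ^+ k.
    rewrite normrM; apply: ler_pM => //.
      apply: horner_le => //.
        by rewrite size_drop_poly (leq_trans (leq_subr _ _)).
      by move=> i; rewrite coef_drop_poly.
    case/andP: z01 => z0 _; rewrite normrX (ger0_norm z0).
    case/andP: h01 => h0 h1; case/andP: c01 => c0 c1.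
    have zh : z <= h by rewrite /z; have := mulr_ge0 (ltW h0) c0; lra.
    by apply: lerXn2r => //; rewrite nnegrE // ltW.
  apply: le_trans (ler_normD _ _) _.
  apply: le_trans (lerD (ler_normD _ _) b3) _.
  apply: le_trans (lerD (lerD b1 b2) (lexx _)) _.
  rewrite natrD k2E.
  have CDh : 0 <= C * D * h ^+ k by exact: mulr_ge0.
  rewrite -subr_ge0.
  set X := (X in 0 <= X); have -> : X = 2 * (k%:R * (C * D * h ^+ k)) by rewrite /X; ring.
  by rewrite !mulr_ge0.
Qed.

Lemma taylorD k (a b : R) u v : taylor k a b u -> taylor k a b v ->
  taylor k a b (fun x => u x + v x).
Proof.
move=> [C C0 uC] [D D0 vD]; exists (C + D); first exact: addr_ge0.
by move=> x h ax h01 xb; apply: expandsD; [exact: uC|exact: vD].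
Qed.

Lemma taylorM k (a b : R) u v : taylor k a b u -> taylor k a b v ->
  taylor k a b (fun x => u x * v x).
Proof.
move=> [C C0 uC] [D D0 vD]; exists ((k.*2 + 1)%:R ^+ 2 * (C * D)).
  by rewrite mulr_ge0 ?exprn_ge0 // mulr_ge0.
by move=> x h ax h01 xb; apply: expandsM => //; [exact: uC|exact: vD].
Qed.

Lemma taylor0 k (a b : R) : taylor k a b (fun=> 0).
Proof.
exists 0 => // x h _ _ _; exists 0; split=> [||c _].
- by rewrite size_poly0.
- by move=> i; rewrite coef0 normr0.
- by rewrite horner0 subrr normr0 mul0r.
Qed.

Lemma taylor_sum k (a b : R) (I : finType) (u : I -> R -> R) :
  (forall i, taylor k a b (u i)) -> taylor k a b (fun x => \sum_i u i x).
Proof.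
move=> tu.
suff: forall r : seq I, taylor k a b (fun x => \sum_(i <- r) u i x) by apply.
elim=> [|i r IH].
  by under eq_fun do rewrite big_nil; exact: taylor0.
by under eq_fun do rewrite big_cons; apply: taylorD.
Qed.

Lemma taylor_bounded (a b M : R) u : (forall x, a <= x <= b -> `|u x| <= M) ->
  taylor 0 a b u.
Proof.
move=> uM; exists `|M| => // x h ax /andP[h0 h1] xb; exists 0; split.
- by rewrite size_poly0.
- by move=> i; rewrite coef0 normr0.
- move=> c /andP[c0 c1]; rewrite horner0 subr0 expr0 mulr1.
  by apply: le_trans (uM _ _) (ler_norm _); apply/andP; split; nra.
Qed.

Lemma within_comp_itv (T : topologicalType) (A B : set R) (g : R -> R) (u : R -> T) :
  continuous g -> (forall x, A x -> B (g x)) ->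
  {within B, continuous u} -> {within A, continuous (fun x => u (g x))}.
Proof.
move=> cg AB /subspace_continuousP cu; apply/subspace_continuousP => x Ax V uV.
have H : nbhs x (fun z => B (g z) -> V (u (g z))) := cg x _ (cu _ (AB _ Ax) V uV).
suff : nbhs x (fun z => A z -> V (u (g z))) by [].
by apply: filterS H => z BV Az; apply: BV; exact: AB.
Qed.

Lemma within_affine (T : topologicalType) (a b x h : R) (u : R -> T) :
  a <= x -> 0 <= h -> x + h <= b -> {within `[a, b], continuous u} ->
  {within `[0, 1], continuous (fun c => u (x + c * h))}.
Proof.
move=> ax h0 xb; apply: (@within_comp_itv _ _ _ (fun c => x + c * h)).
  by move=> c; apply: cvgD; [exact: cvg_cst|apply: cvgM; [exact: cvg_id|exact: cvg_cst]].
move=> c; rewrite /= !in_itv /= => /andP[c0 c1].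
by apply/andP; split; nra.
Qed.

(** The expansion of [u] is its value at the end of the step minus a primitive of
    the expansion of [v]; the mean value theorem bounds the remainder with one
    more power of [h]. *)
Lemma taylor_primitive k (a b : R) u v : {within `[a, b], continuous u} ->
  (forall x : R, a < x < b -> is_derive x 1 u (v x)) ->
  taylor k a b v -> taylor k.+1 a b u.
Proof.
move=> cu du [C C0 vC].
have [M M0 uM] : exists2 M : R, 0 <= M & forall x, a <= x <= b -> `|u x| <= M.
  have [ba|ab] := ltP b a; first by exists 0 => // x /andP[]; lra.
  have cu' : {within `[a, b], continuous (fun x => `|u x|)}.
    move=> x; apply: continuous_comp; [exact: cu | exact: norm_continuous].
  by have [c _ ?] := EVT_max ab cu'; exists `|u c|.
exists (M + C) => [|x h ax h01 xb]; first exact: addr_ge0.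
have [h0 h1] := andP h01.
have [p [sp pC vp]] := vC _ _ ax h01 xb.
pose q : {poly R} := \poly_(i < k.+1) (p`_i.-1 / i%:R *+ (i != 0)%N).
have qE : q^`() = p.
  apply/polyP => i; rewrite coef_deriv coef_poly ltnS /=.
  case: ltnP => [ik|ki].
    by rewrite mulr1n -[LHS]mulr_natr divfK // pnatr_eq0.
  by rewrite mul0rn (leq_sizeP _ _ sp).
have q0 : q.[0] = 0 by rewrite horner_coef0 coef_poly /= mulr0n.
have qC i : `|q`_i| <= C.
  rewrite coef_poly; case: ltnP => _; last by rewrite normr0.
  case: i => [|i]; first by rewrite mulr0n normr0.
  rewrite mulr1n normrM -[C]mulr1; apply: ler_pM => //.
  by rewrite normfV normr_nat invf_le1 // ler1n.
exists ((u (x + h))%:P - q); split.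
- rewrite (leq_trans (size_polyD _ _)) // geq_max size_polyN.
  by rewrite (leq_trans (size_polyC_leq1 _)) //= size_poly.
- move=> i; rewrite coefB coefC; apply: le_trans (ler_normB _ _) _.
  apply: lerD => //; case: ifP => _; last by rewrite normr0.
  by apply: uM; apply/andP; split; lra.
move=> c /andP[c0 c1]; rewrite hornerD hornerN hornerC.
pose D c := u (x + c * h) + q.[h * (1 - c)].
have dD (z : R) : z \in `]c, 1[ -> is_derive z 1 D
    (h * v (x + z * h) - h * p.[h * (1 - z)]).
  rewrite in_itv /= => /andP[cz z1].
  have d1 : is_derive z 1 (fun c => u (x + c * h)) (h * v (x + z * h)).
    by apply/is_derive_affine/du; apply/andP; split; nra.
  have d2 : is_derive z 1 (fun c => q.[h + c * - h]) (- h * p.[h + z * - h]).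
    by rewrite -qE; apply: is_derive_affine; exact: is_derive_poly.
  have -> : D = (fun c => u (x + c * h)) + (fun c => q.[h + c * - h]).
    by apply/funext => e; rewrite /D fctE; congr (_ + q.[_]); ring.
  apply: is_derive_eq; rewrite mulNr; congr (_ - _ * p.[_]); ring.
have cD : {within `[c, 1], continuous D}.
  suff : c01 D by apply: continuous_subspaceW => z; rewrite /= !in_itv /=; lra.
  apply: c01D; first exact: within_affine (ltW h0) xb cu.
  apply: (@within_comp_itv _ _ setT (fun c => h * (1 - c)) (horner q)) => //.
    move=> z; apply: cvgM; first exact: cvg_cst.
    by apply: cvgB; [exact: cvg_cst|exact: cvg_id].
  by apply: continuous_subspaceT; exact: continuous_horner.
have [z zc Dz] := MVT_segment c1 dD cD.
have -> : u (x + c * h) - (u (x + h) - q.[h * (1 - c)]) = - (D 1 - D c).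
  by rewrite /D mul1r subrr mulr0 q0; ring.
rewrite normrN Dz -mulrBr normrM normrM (gtr0_norm h0).
have [cz z1] : c <= z /\ z <= 1 by move: zc; rewrite in_itv /= => /andP[].
have z01 : 0 <= z <= 1 by lra.
have c1' : `|1 - c| <= 1 by rewrite ger0_norm; lra.
apply: (@le_trans _ _ (h * (C * h ^+ k) * 1)).
  apply: ler_pM => //; first by rewrite mulr_ge0 // ltW.
  by apply: ler_wpM2l; [exact: ltW | exact: vp].
rewrite mulr1 mulrCA -exprS; apply: ler_wpM2r; first by apply/exprn_ge0/ltW.
by rewrite lerDr.
Qed.

End TaylorClass.

(** * Maps of class C^k *)

Section CkFunctions.
Variable R : realType.

Lemma Ck_continuous (V W : normedModType R) k (g : V -> W) :
  Ck k g -> continuous g.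
Proof.
by case: k => [//|k] [dg _] x; apply: differentiable_continuous; exact: dg.
Qed.

Lemma Ck_pred (V W : normedModType R) k (g : V -> W) : Ck k.+1 g -> Ck k g.
Proof.
elim: k g => [|k IH] g; first exact: Ck_continuous.
by move=> [dg Dg]; split=> // v; apply: IH; exact: Dg.
Qed.

Lemma Ck_leq (V W : normedModType R) k l (g : V -> W) :
  (k <= l)%N -> Ck l g -> Ck k g.
Proof.
move=> /subnK <-; elim: (l - k)%N => [//|n IH] Cg.
by apply: IH; exact: Ck_pred.
Qed.

Lemma Ck_coord (V : normedModType R) m k (g : V -> 'rV[R]_m) i :
  Ck k g -> Ck k (fun x => g x 0 i).
Proof.
elim: k g => [|k IH] g.
  move=> cg x; apply: (@continuous_comp _ _ _ g (fun M : 'rV[R]_m => M 0 i)).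
    exact: cg.
  exact: coord_continuous.
move=> [dg Dg]; split=> [x|v].
  apply: (@differentiable_comp _ _ _ _ g (fun M : 'rV[R]_m => M 0 i)) => //.
  exact: differentiable_coord.
have -> : 'D_v (fun x => g x 0 i) = (fun x => ('D_v g) x 0 i).
  apply/funext => x; rewrite derive_mx ?mxE //.
  exact: diff_derivable.
by apply: IH; exact: Dg.
Qed.

(** Induction on [k], each derivative being a primitive of the next one. *)
Lemma taylor_Ck k (a b : R) (u : R -> R) : Ck k (u : R^o -> R) -> taylor k a b u.
Proof.
elim: k u => [|k IH] u.
  move=> cu; have [ba|ab] := ltP b a.
    by apply: (@taylor_bounded _ _ _ 0) => x /andP[]; lra.
  have cu' : {within `[a, b], continuous (fun x => `|u x|)}.
    apply: continuous_subspaceT => x.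
    by apply: continuous_comp; [exact: cu | exact: norm_continuous].
  have [c _ M] := EVT_max ab cu'.
  by apply: (@taylor_bounded _ _ _ `|u c|) => x ?; apply: M; rewrite in_itv.
move=> [du Du]; apply: (@taylor_primitive _ _ _ _ _ ('D_1 (u : R^o -> R))).
- apply: continuous_subspaceT => x; exact: differentiable_continuous.
- by move=> x _; apply: DeriveDef => //; exact: diff_derivable.
- exact: IH (Du 1).
Qed.

Variable m : nat.
Local Notation V := ('rV[R]_m * 'rV[R]_m)%type.

(** Indices on the left stand for the current value, on the right for the delayed
    value. *)
Definition vdir (a : 'I_m + 'I_m) : V :=
  match a with inl i => (delta_mx 0 i, 0) | inr i => (0, delta_mx 0 i) end.

Definition pcoord (v : V) (a : 'I_m + 'I_m) : R :=
  match a with inl i => v.1 0 i | inr i => v.2 0 i end.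

Lemma pcoord_sum (v : V) : v = \sum_a pcoord v a *: vdir a.
Proof.
rewrite big_sumType /=; case: v => v1 v2 /=.
have fstS (r : seq 'I_m) (F : 'I_m -> V) :
    (\sum_(i <- r) F i).1 = \sum_(i <- r) (F i).1 by elim/big_rec2: _ => // i ? ? _ <-.
have sndS (r : seq 'I_m) (F : 'I_m -> V) :
    (\sum_(i <- r) F i).2 = \sum_(i <- r) (F i).2 by elim/big_rec2: _ => // i ? ? _ <-.
rewrite [LHS]surjective_pairing [RHS]surjective_pairing; congr pair => /=.
  rewrite !fstS [X in _ + X]big1 /= ?addr0; first exact: row_sum_delta.
  by move=> i _; rewrite scaler0.
rewrite !sndS [X in X + _]big1 /= ?add0r; first exact: row_sum_delta.
by move=> i _; rewrite scaler0.
Qed.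

Lemma deriveE_coord (g : V -> R) x v : differentiable g x ->
  'D_v g x = \sum_a pcoord v a * 'D_(vdir a) g x.
Proof.
move=> dg; rewrite deriveE // {1}(pcoord_sum v) linear_sum; apply: eq_bigr => a _.
by rewrite linearZ /= deriveE.
Qed.

Lemma is_derive_curve (g : V -> R) (c : R -> V) (d : 'I_m + 'I_m -> R) (t : R) :
  differentiable g (c t) ->
  (forall a, is_derive t 1 (fun t => pcoord (c t) a) (d a)) ->
  is_derive t 1 (fun t => g (c t)) (\sum_a d a * 'D_(vdir a) g (c t)).
Proof.
move=> dg dc.
have d1 : derivable (fun t => (c t).1) t 1.
  by apply/derivable_mxP => i j; rewrite ord1; have [] := dc (inl j).
have d2 : derivable (fun t => (c t).2) t 1.
  by apply/derivable_mxP => i j; rewrite ord1; have [] := dc (inr j).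
have f1 := (derivable1_diffP _ _).1 d1; have f2 := (derivable1_diffP _ _).1 d2.
have cE : (fun t => ((c t).1, (c t).2)) = c.
  by apply/funext => z; rewrite -surjective_pairing.
have dc' : differentiable c t by have := differentiable_pair f1 f2; rewrite cE.
have Dc : 'd c t 1 = ('D_1 (fun t => (c t).1) t, 'D_1 (fun t => (c t).2) t).
  rewrite (deriveE _ f1) (deriveE _ f2); have := diff_pair f1 f2; rewrite cE.
  by move=> ->.
have dgc := @differentiable_comp _ _ _ _ c g _ dc' dg.
apply: DeriveDef; first exact/derivable1_diffP.
rewrite (deriveE _ dgc).
have -> : 'd (g \o c) t 1 = 'd g (c t) ('d c t 1) by rewrite (@diff_comp _ _ _ _ c g).
rewrite Dc -(deriveE _ dg).
rewrite deriveE_coord //; apply: eq_bigr => a _; congr (_ * _).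
have [_ <-] := dc a; case: a => i; rewrite {1}/pcoord ?(derive_mx d1) ?(derive_mx d2) [LHS]mxE.
  by [].
by [].
Qed.

Definition box (rho : R) : set V := [set v | forall a, `|pcoord v a| <= rho].

Lemma box_compact rho : compact (box rho).
Proof.
pose B := [set x : 'rV[R]_m | forall i, x 0 i \in `[- rho, rho]].
have cB : compact B.
  by apply: (@rV_compact _ _ (fun=> `[- rho, rho]%classic)) => _; exact: segment_compact.
suff -> : box rho = B `*` B by exact: compact_setX.
apply/seteqP; split=> [v bv|v [b1 b2] [] i] /=.
- split=> i /=; rewrite in_itv /= -ler_norml.
    exact: bv (inl i).
  exact: bv (inr i).
- by have := b1 i; rewrite in_itv /= -ler_norml.
- by have := b2 i; rewrite in_itv /= -ler_norml.
Qed.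

Lemma box_bounded rho (g : V -> R) : continuous g ->
  exists2 B : R, 0 <= B & forall v, box rho v -> `|g v| <= B.
Proof.
move=> cg; have cgb : {within box rho, continuous g} by exact: continuous_subspaceT.
have [M [_ gM]] := compact_bounded (continuous_compact cgb (@box_compact rho)).
exists (`|M| + 1) => [|v bv]; first exact: addr_ge0.
apply: (gM (`|M| + 1)); last by exists v.
by rewrite (le_lt_trans (ler_norm M)) // ltrDl.
Qed.

Lemma mean_value (g : V -> R) (x v : V) : (forall x, differentiable g x) ->
  exists2 t : R, 0 <= t <= 1 &
    g (x + v) - g x = \sum_a pcoord v a * 'D_(vdir a) g (x + t *: v).
Proof.
move=> dg.
have dc (t : R) : is_derive t 1 (fun t : R => g (x + t *: v))
    (\sum_a pcoord v a * 'D_(vdir a) g (x + t *: v)).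
  apply: (@is_derive_curve g (fun t => x + t *: v)) => // a.
  have -> : (fun t : R => pcoord (x + t *: v) a) =
      (fun t => id (pcoord x a + t * pcoord v a)).
    by apply/funext => z; case: a => i; rewrite /= !mxE.
  have := @is_derive_affine _ id (pcoord x a) (pcoord v a) t 1 (is_derive_id _ _).
  by rewrite mulr1.
have cg : {within `[0, 1], continuous (fun t : R => g (x + t *: v))}.
  apply: continuous_subspaceT => z.
  have dz : differentiable (fun t : R => g (x + t *: v)) z.
    by apply/derivable1_diffP; case: (dc z).
  exact: differentiable_continuous dz.
have [t t01] := MVT_segment ler01 (fun t _ => dc t) cg.
rewrite scale1r scale0r addr0 subr0 mulr1 => E; by exists t.
Qed.

Lemma pcoordB (x y : V) a : pcoord (x - y) a = pcoord x a - pcoord y a.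
Proof. by case: a => i /=; rewrite !mxE. Qed.

Lemma pcoordD (x y : V) a : pcoord (x + y) a = pcoord x a + pcoord y a.
Proof. by case: a => i /=; rewrite !mxE. Qed.

Lemma pcoordZ (t : R) (y : V) a : pcoord (t *: y) a = t * pcoord y a.
Proof. by case: a => i /=; rewrite !mxE. Qed.

(** The mean value theorem is used twice: for [g] between [y] and [x], then for its
    partial derivatives between the intermediate point and [x].  The second
    partial derivatives are bounded on the box by compactness. *)
Lemma quadratic_remainder (g : V -> R) rho : Ck 2 g ->
  exists2 Q : R, 0 <= Q & forall x y, box rho x -> box rho y ->
    forall w, (forall a, `|pcoord x a - pcoord y a| <= w) ->
    `|g x - g y - \sum_a (pcoord x a - pcoord y a) * 'D_(vdir a) g x| <= Q * w ^+ 2.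
Proof.
move=> C2; have [dg Dg] := C2.
have dDg a x : differentiable ('D_(vdir a) g) x by have [] := Dg (vdir a).
have /choice[B HB] (ab : ('I_m + 'I_m) * ('I_m + 'I_m)) : exists B, 0 <= B /\
    forall v, box rho v -> `|'D_(vdir ab.2) ('D_(vdir ab.1) g) v| <= B.
  have [B B0 HB] : exists2 B : R, 0 <= B &
      forall v, box rho v -> `|'D_(vdir ab.2) ('D_(vdir ab.1) g) v| <= B.
    by apply: box_bounded; have [_ /(_ (vdir ab.2))] := Dg (vdir ab.1).
  by exists B.
exists (\sum_a \sum_b B (a, b)) => [|x y bx by_ w xyw].
  by apply: sumr_ge0 => a _; apply: sumr_ge0 => b _; have [] := HB (a, b).
have segm (t : R) : 0 <= t <= 1 -> box rho (y + t *: (x - y)).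
  move=> /andP[t0 t1] a; rewrite pcoordD pcoordZ pcoordB.
  have -> : pcoord y a + t * (pcoord x a - pcoord y a) =
     (1 - t) * pcoord y a + t * pcoord x a by ring.
  apply: le_trans (ler_normD _ _) _; rewrite !normrM (ger0_norm t0).
  rewrite ger0_norm ?subr_ge0 //.
  have := ler_wpM2l t0 (bx a); have t1' : 0 <= 1 - t by lra.
  have := ler_wpM2l t1' (by_ a); lra.
have [t t01] := @mean_value g y (x - y) dg.
rewrite subrKC => ->; rewrite -sumrB mulr_suml.
apply: le_trans (ler_norm_sum _ _ _) _; apply: ler_sum => a _.
have w0 : 0 <= w by apply: le_trans (xyw a).
rewrite pcoordB -mulrBr normrM expr2 mulrA [_ * w]mulrC mulrC [leRHS]mulrC.
set z := y + _; have bz : box rho z by exact: segm.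
apply: ler_pM => //.
have zxE : x = z + (1 - t) *: (x - y).
  by rewrite /z -addrA -scalerDl subrKC scale1r subrKC.
have [t' t01' E] := @mean_value ('D_(vdir a) g) z (x - z) (dDg a).
have E2 : 'D_(vdir a) g x = 'D_(vdir a) g (z + (x - z)) by rewrite subrKC.
rewrite E2 -normrN opprB E mulr_suml.
apply: le_trans (ler_norm_sum _ _ _) _; apply: ler_sum => b _.
rewrite normrM mulrC; apply: ler_pM => //.
  have [_] := HB (a, b); apply.
  move=> e; rewrite pcoordD pcoordZ pcoordB.
  case/andP: t01' => t0 t1.
  have -> : pcoord z e + t' * (pcoord x e - pcoord z e) =
     (1 - t') * pcoord z e + t' * pcoord x e by ring.
  apply: le_trans (ler_normD _ _) _; rewrite !normrM (ger0_norm t0).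
  rewrite ger0_norm ?subr_ge0 //.
  have := ler_wpM2l t0 (bx e); have t1' : 0 <= 1 - t' by lra.
  have := ler_wpM2l t1' (bz e); lra.
have -> : x - z = (1 - t) *: (x - y) by rewrite {1}zxE addrAC subrr add0r.
case/andP: t01 => t0 t1.
rewrite pcoordZ normrM ger0_norm ?subr_ge0 // -[w]mul1r pcoordB.
by apply: ler_pM => //; lra.
Qed.

End CkFunctions.

(** * Regularity of the solution between multiples of the delay *)

Section Blocks.
Variables (R : realType) (m : nat).
Local Notation V := ('rV[R]_m * 'rV[R]_m)%type.
Implicit Types (f : V -> 'rV[R]_m) (Y : R -> 'rV[R]_m) (d : 'I_m -> R -> R).

Lemma taylor_shift k (a b x0 : R) (u : R -> R) :
  taylor k (x0 + a) (x0 + b) u -> taylor k a b (fun x => u (x0 + x)).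
Proof.
move=> [C C0 uC]; exists C => // x h ax h01 xb.
under eq_fun do rewrite addrA; apply: uC => //; first by rewrite lerD2l.
by rewrite -addrA lerD2l.
Qed.

(** The derivative of [g (c x)] is a sum of products of a partial derivative of [g]
    along [c] with either a component of [f] along [c] or the derivative of the
    delayed component.  The induction on [k] is over all [g] at once, so each factor
    has an expansion of order [k], and [taylor_primitive] gains one order. *)
Lemma taylor_ode s (a b : R) f (c : R -> V) (d : 'I_m + 'I_m -> R -> R) :
  Ck s f -> {within `[a, b], continuous c} ->
  (forall (x : R) e, a < x < b -> is_derive x 1 (fun x => pcoord (c x) e) (d e x)) ->
  (forall i x, d (inl i) x = f (c x) 0 i) ->
  (forall i k, (k <= s)%N -> taylor k a b (d (inr i))) ->
  forall k (g : V -> R), (k <= s)%N -> Ck k g -> taylor k a b (fun x => g (c x)).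
Proof.
move=> Cf cc dc dl dr; elim=> [|k IH] g ks Cg.
  have cg : {within `[a, b], continuous (fun x => `|g (c x)|)}.
    move=> x; apply: (@continuous_comp _ _ _ (c : subspace _ -> V) (fun v => `|g v|)).
      exact: cc.
    by apply: continuous_comp; [exact: Cg | exact: norm_continuous].
  have [ba|ab] := ltP b a.
    by apply: (@taylor_bounded _ _ _ 0) => x /andP[]; lra.
  have [z _ M] := EVT_max ab cg.
  by apply: (@taylor_bounded _ _ _ `|g (c z)|) => x ?; apply: M; rewrite in_itv.
have ks' : (k <= s)%N by exact: ltnW.
have [dg Dg] := Cg.
apply: (@taylor_primitive _ _ _ _ _ (fun x => \sum_e d e x * 'D_(vdir R e) g (c x))).
- move=> x; apply: (@continuous_comp _ _ _ (c : subspace _ -> V) g); first exact: cc.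
  exact: Ck_continuous Cg _.
- by move=> x xab; apply: is_derive_curve => // e; exact: dc.
- apply: taylor_sum => e; apply: taylorM; last by apply: (IH ('D_(vdir R e) g)) => //; exact: Dg.
  case: e => i; last exact: dr.
  have -> : d (inl i) = (fun x => f (c x) 0 i) by apply/funext => x.
  by apply: (IH (fun v => f v 0 i)) => //; apply: Ck_coord; exact: Ck_leq Cf.
Qed.

(** [Y] need not be differentiable at the end points, but its derivative has
    expansions up to them. *)
Definition smooth_block s (tau : R) Y d :=
  [/\ {within `[0, tau], continuous Y},
      forall (x : R) i, 0 < x < tau -> is_derive x 1 (fun x => Y x 0 i) (d i x) &
      forall i k, (k <= s)%N -> taylor k 0 tau (d i)].

Lemma is_derive_coord (Y : R -> 'rV[R]_m) (x : R) (l : 'rV[R]_m) i :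
  is_derive x 1 Y l -> is_derive x 1 (fun x => Y x 0 i) (l 0 i).
Proof.
move=> [dY <-]; apply: DeriveDef; last by rewrite derive_mx // mxE.
by have := (derivable_mxP _ _ _).1 dY 0 i.
Qed.

(** Near an interior point the restriction to the interval is no restriction. *)
Lemma is_derive_interior (a b x : R) (Y : R -> 'rV[R]_m) l : a < x < b ->
  is_derive_within `[a, b] x Y l -> is_derive x 1 Y l.
Proof.
move=> /andP[ax xb] YL.
suff H : h^-1 *: ((Y \o shift x) (h *: (1:R)) - Y x) @[h --> 0^'] --> l.
  by apply: DeriveDef; [apply/cvg_ex; exists l | exact: cvg_lim].
apply/cvgrPdist_lt => e e0.
have FF : Filter (within `[a, b] x^') by exact: within_filter.
have [r /= r0 rY] : nbhs x (fun u => u != x -> `[a, b]%classic u ->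
    `|l - (u - x)^-1 *: (Y u - Y x)| < e) := (cvgrPdist_lt _ _).1 YL e e0.
have ax0 : 0 < x - a by lra. have xb0 : 0 < b - x by lra.
near=> h.
have hn0 : h != 0 by near: h; exact: nbhs_dnbhs_neq.
have hr : `|h| < r by near: h; exact: dnbhs0_lt.
have ha : `|h| < x - a by near: h; exact: dnbhs0_lt.
have hb : `|h| < b - x by near: h; exact: dnbhs0_lt.
have := rY (h + x).
rewrite /ball_ /= addrK /GRing.scale /= mulr1; apply.
- by rewrite opprD addrCA subrr addr0 normrN.
- by rewrite -subr_eq0 addrK.
- by rewrite in_itv /=; move: ha hb; rewrite !ltr_norml; lra.
Unshelve. all: by end_near. Qed.

(** The history [phi] is block 0, and the solution on
    the interval from [t0 + j tau] to [t0 + (j+1) tau] is block [j+1], both moved to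
    the interval from 0 to [tau].  The
    argument delayed by [tau] is then the same point of the preceding block, and
    the two possible values at [t0], [phi t0] and [y0], belong to different
    blocks. *)
Definition block phi y (t0 tau : R) j (x : R) : 'rV[R]_m :=
  if j is j'.+1 then y (t0 + j'%:R * tau + x) else phi (t0 - tau + x).

Lemma smooth_block0 s phi y (t0 tau : R) :
  Ck_itv s.+1 (t0 - tau) t0 phi ->
  exists d, smooth_block s tau (block phi y t0 tau 0) d.
Proof.
move=> [g Cg phig]; have [dg Dg] := Cg.
exists (fun i x => ('D_1 (g : R^o -> _) (t0 - tau + x)) 0 i); split.
- have cg : {within `[0, tau], continuous (fun x => g (t0 - tau + x))}.
    apply: continuous_subspaceT => x; apply: (@continuous_comp _ _ _ (fun x => t0 - tau + x)).
      by apply: cvgD; [exact: cvg_cst|exact: cvg_id].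
    exact: Ck_continuous Cg _.
  apply: subspace_eq_continuous cg => x; rewrite inE /= in_itv /= => /andP[x0 x1].
  by apply/esym/phig; rewrite in_itv /=; apply/andP; split; lra.
- move=> x i /andP[x0 x1].
  have dgx : is_derive (t0 - tau + x * 1) 1 (fun x => g x 0 i)
      ('D_1 (g : R^o -> _) (t0 - tau + x) 0 i).
    rewrite mulr1; apply: is_derive_coord; apply: DeriveDef => //.
    exact: diff_derivable.
  have := is_derive_affine dgx; rewrite mul1r; apply: near_eq_is_derive => //.
  near=> z; rewrite mulr1 /=; suff -> : phi (t0 - tau + z) = g (t0 - tau + z) by [].
  apply: phig; rewrite in_itv /=.
  have : 0 < z < tau.
    by near: z; apply: (@near_in_itvoo _ 0 tau); rewrite in_itv /= x0.
  by move=> /andP[? ?]; apply/andP; split; lra.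
- move=> i k ks.
  apply: (@taylor_shift k 0 tau (t0 - tau) (fun x => ('D_1 (g : R^o -> _) x) 0 i)).
  apply: (@taylor_Ck _ _ _ _ (fun x => ('D_1 (g : R^o -> _) x) 0 i)).
  by apply: Ck_coord; apply: Ck_leq (Dg 1).
Unshelve. all: by end_near. Qed.

(** The preceding block provides the regularity of the delayed argument.  The
    exempted point [t0 + tau] is never inside a block. *)
Lemma smooth_blockS s f phi y (t0 tau T : R) K y0 :
  0 < tau -> T - t0 = K%:R * tau -> Ck s f ->
  dde_solution f phi t0 tau T y0 y ->
  forall j d, (j < K)%N -> smooth_block s tau (block phi y t0 tau j) d ->
  (forall k (g : V -> R), (k <= s)%N -> Ck k g -> taylor k 0 tau
     (fun x => g (block phi y t0 tau j.+1 x, block phi y t0 tau j x))) /\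
  smooth_block s tau (block phi y t0 tau j.+1)
    (fun i x => f (block phi y t0 tau j.+1 x, block phi y t0 tau j x) 0 i).
Proof.
move=> tau0 TE Cf [cy yt0 yphi dy] j d jK [cj dj tj].
have jT : t0 + j%:R * tau + tau <= T.
  have : (j.+1%:R : R) <= K%:R by rewrite ler_nat.
  rewrite -natr1; nra.
have jt0 : t0 <= t0 + j%:R * tau by rewrite lerDl mulr_ge0 // ltW.
have cj1 : {within `[0, tau], continuous (block phi y t0 tau j.+1)}.
  apply: (@within_comp_itv _ _ _ `[t0, T]%classic (fun x => t0 + j%:R * tau + x)) => //.
    by move=> x; apply: cvgD; [exact: cvg_cst|exact: cvg_id].
  by move=> x; rewrite /= !in_itv /= => /andP[? ?]; apply/andP; split; lra.
have dj1 (x : R) i : 0 < x < tau -> is_derive x 1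
    (fun x => block phi y t0 tau j.+1 x 0 i)
    (f (block phi y t0 tau j.+1 x, block phi y t0 tau j x) 0 i).
  move=> /andP[x0 x1]; set t := t0 + j%:R * tau + x.
  have tt : t0 < t < T by rewrite /t; apply/andP; split; lra.
  have tj0 : t = t0 + tau -> phi t0 = y0.
    move=> tE; exfalso; move: tE; rewrite /t; case: (j) => [|j'].
      by rewrite mul0r; lra.
    by rewrite -natr1; have : 0 <= j'%:R * tau by [rewrite mulr_ge0 // ltW]; lra.
  have tt' : t0 <= t <= T by move: tt => /andP[? ?]; apply/andP; split; lra.
  have /(is_derive_interior tt) dyt := dy t tt' tj0.
  have yE : y (t - tau) = block phi y t0 tau j x.
    rewrite /t /block; case: (j) => [|j'].
      rewrite mul0r addr0 yphi; first by congr phi; lra.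
      by apply/andP; split; lra.
    by congr y; rewrite -natr1; ring.
  have dyi : is_derive (t0 + j%:R * tau + x * 1) 1 (fun x => y x 0 i)
      (f (block phi y t0 tau j.+1 x, block phi y t0 tau j x) 0 i).
    by rewrite mulr1 -yE; exact: is_derive_coord dyt.
  have := is_derive_affine dyi; rewrite mul1r.
  by under eq_fun do rewrite mulr1.
have H := @taylor_ode s 0 tau f
  (fun x => (block phi y t0 tau j.+1 x, block phi y t0 tau j x))
  (fun e => match e with
    | inl i => fun x => f (block phi y t0 tau j.+1 x, block phi y t0 tau j x) 0 i
    | inr i => d i end) Cf.
have {}H : forall k (g : V -> R), (k <= s)%N -> Ck k g -> taylor k 0 tau
     (fun x => g (block phi y t0 tau j.+1 x, block phi y t0 tau j x)).
  apply: H => //.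
  - apply/subspace_continuousP => x xA.
    have h1 := ((subspace_continuousP _ _).1 cj1) x xA.
    have h2 := ((subspace_continuousP _ _).1 cj) x xA.
    exact: cvg_pair h1 h2.
  - by move=> x [i|i] x01; [exact: (dj1 x i x01)|exact: (dj x i x01)].
by split=> //; split=> // i k ks; apply: (H k (fun v => f v 0 i)) => //;
  apply: Ck_coord; exact: Ck_leq Cf.
Qed.

End Blocks.

(** * Moments and smooth factors *)

Section ExpandsMoments.
Variables (R : realType) (P : nat -> {poly R}).
Hypothesis LP : legendre_basis P.

(** The residual vanishes on polynomials of degree less than [s], so only the
    remainder of the expansion contributes. *)
Lemma expands_residual s (h A CP : R) v : 0 <= A ->
  (forall u (M : R), c01 u -> (forall x : R, 0 <= x <= 1 -> `|u x| <= M) ->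
    forall x : R, 0 <= x <= 1 -> `|legendre_proj P s u x| <= CP * M) ->
  0 < h -> c01 v -> expands s h A v ->
  forall x : R, 0 <= x <= 1 -> `|v x - legendre_proj P s v x| <= (1 + CP) * (A * h ^+ s).
Proof.
move=> A0 HCP h0 cv [p [sp pA vp]] x x01.
pose q : {poly R} := p \Po (h *: (1 - 'X)).
have qE (z : R) : q.[z] = p.[h * (1 - z)] by rewrite horner_comp !hornerE.
have sq : (size q <= s)%N.
  have [pE|p0] := eqVneq p 0; first by rewrite /q pE comp_poly0 size_poly0.
  have s2 : (size (h *: (1 - 'X : {poly R})) <= 2)%N.
    by rewrite (leq_trans (size_scale_leq _ _)) // -opprB size_polyN size_XsubC.
  rewrite /q; apply: leq_trans (size_comp_poly_leq _ _) _.
  have p1 : (0 < size p)%N by rewrite size_poly_gt0.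
  apply: leq_trans sp; rewrite -[X in (_ <= X)%N](prednK p1) ltnS.
  by rewrite -[X in (_ <= X)%N]muln1 leq_mul2l; apply/orP; right; case: (size _) s2 => [|[|[]]].
have -> : v x - legendre_proj P s v x = (v x - q.[x]) - legendre_proj P s (fun z => v z - q.[z]) x.
  by rewrite projB ?(proj_id LP sq) //; [ring | exact: c01_poly].
have b z : 0 <= z <= 1 -> `|v z - q.[z]| <= A * h ^+ s by rewrite qE; exact: vp.
apply: le_trans (ler_normB _ _) _; rewrite mulrDl mul1r; apply: lerD; first exact: b.
by apply: HCP => //; apply: c01B => //; exact: c01_poly.
Qed.

Lemma momentD l (u v : R -> R) : c01 u -> c01 v ->
  moment l (fun x => u x + v x) = moment l u + moment l v.
Proof.
move=> cu cv; rewrite /moment; under eq_fun do rewrite mulrDr.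
by rewrite I01D //; apply: c01M => //; exact: c01_onemX.
Qed.

Lemma momentB l (u v : R -> R) : c01 u -> c01 v ->
  moment l (fun x => u x - v x) = moment l u - moment l v.
Proof.
move=> cu cv; rewrite /moment; under eq_fun do rewrite mulrBr.
by rewrite I01B //; apply: c01M => //; exact: c01_onemX.
Qed.

Lemma momentZ l a (u : R -> R) : c01 u ->
  moment l (fun x => a * u x) = a * moment l u.
Proof.
move=> cu; rewrite /moment; under eq_fun do rewrite mulrCA.
by rewrite I01Z //; apply: c01M => //; exact: c01_onemX.
Qed.

Lemma moment_sum l (I : finType) (u : I -> R -> R) : (forall i, c01 (u i)) ->
  moment l (fun x => \sum_i u i x) = \sum_i moment l (u i).
Proof.
move=> cu; rewrite /moment; under eq_fun do rewrite mulr_sumr.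
by rewrite I01_sum // => i; apply: c01M => //; exact: c01_onemX.
Qed.

Lemma c01_horner_onem (p : {poly R}) (h : R) : c01 (fun x => p.[h * (1 - x)]).
Proof.
have -> : (fun x : R => p.[h * (1 - x)]) = horner (p \Po (h *: (1 - 'X))).
  by apply/funext => x; rewrite horner_comp !hornerE.
exact: c01_poly.
Qed.

(** The term of degree [q] of [F] carries [h^q] and turns the moment of order [i]
    into the one of order [i + q], so that it is bounded by [A E]; from order [s]
    on, the sup bound [w] replaces the bound of the moments. *)
Lemma moment_expands s i (h A E w : R) (F v : R -> R) :
  0 < h <= 1 -> 0 <= A -> c01 F -> c01 v -> expands s h A F ->
  (forall x : R, 0 <= x <= 1 -> `|v x| <= w) -> h ^+ s * w <= E ->
  (forall l, (i <= l < s)%N -> h ^+ l * `|moment l v| <= E) ->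
  h ^+ i * `|moment i (fun x => F x * v x)| <= s.+1%:R * (A * E).
Proof.
move=> h01 A0 cF cv [p [sp pA Fp]] vw wE mE.
have [h0 h1] := andP h01; have hn n : 0 <= h ^+ n by apply/exprn_ge0/ltW.
have w0 : 0 <= w by apply: le_trans (vw 0 _); rewrite // lexx ler01.
have mE' l : (i <= l)%N -> h ^+ l * `|moment l v| <= E.
  move=> il; have [ls|sl] := ltnP l s; first by apply: mE; rewrite il.
  apply: le_trans wE; apply: ler_pM => //; last exact: moment_le.
  by apply: ler_wiXn2l => //; exact: ltW.
have E0 : 0 <= E by apply: le_trans (mE' i _) => //; exact: mulr_ge0.
pose e x := F x - p.[h * (1 - x)].
have ce : c01 e by apply: c01B => //; exact: c01_horner_onem.
have cterm (q : 'I_s) : c01 (fun x => (p`_q * h ^+ q) * ((1 - x) ^+ q * v x)).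
  by apply: c01Z; apply: c01M => //; exact: c01_onemX.
have -> : moment i (fun x => F x * v x) =
    \sum_(q < s) (p`_q * h ^+ q) * moment (i + q) v + moment i (fun x => e x * v x).
  have -> : (fun x => F x * v x) =
      (fun x => \sum_(q < s) (p`_q * h ^+ q) * ((1 - x) ^+ q * v x) + e x * v x).
    apply/funext => x; rewrite /e mulrBl addrCA -[LHS]addr0; congr (_ + _).
    apply/eqP; rewrite eq_sym subr_eq0 (horner_coef_wide _ sp) mulr_suml; apply/eqP.
    by apply: eq_bigr => q _; rewrite exprMn; ring.
  rewrite momentD; [|exact: c01_sum|exact: c01M].
  rewrite moment_sum //; congr (_ + _); apply: eq_bigr => q _.
  rewrite momentZ; last by apply: c01M => //; exact: c01_onemX.
  congr (_ * _); apply: I01_ext => x _; by rewrite mulrA -exprD.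
have -> : h ^+ i * `|\sum_(q < s) (p`_q * h ^+ q) * moment (i + q) v +
    moment i (fun x => e x * v x)| = `|\sum_(q < s) p`_q * (h ^+ (i + q) * moment (i + q) v) +
    h ^+ i * moment i (fun x => e x * v x)|.
  rewrite -{1}(ger0_norm (hn i)) -normrM mulrDr mulr_sumr; congr (`| _ + _|).
  by apply: eq_bigr => q _; rewrite exprD; ring.
apply: le_trans (ler_normD _ _) _; rewrite -natr1 mulrDl mul1r; apply: lerD.
  apply: le_trans (ler_norm_sum _ _ _) _.
  rewrite mulr_natl -[s in leRHS]card_ord -sumr_const; apply: ler_sum => q _.
  rewrite normrM; apply: ler_pM => //; rewrite normrM ger0_norm //.
  by apply: mE'; exact: leq_addr.
rewrite normrM ger0_norm //.
have : `|moment i (fun x => e x * v x)| <= A * (h ^+ s * w).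
  apply: moment_le; first exact: c01M.
  move=> x x01; rewrite normrM mulrA; apply: ler_pM => //; [exact: Fp | exact: vw].
have hi1 : h ^+ i <= 1 by apply: exprn_ile1 => //; exact: ltW.
move=> me; rewrite -[A * E]mul1r; apply: ler_pM => //.
by apply: le_trans me _; exact: ler_wpM2l.
Qed.

End ExpandsMoments.

(** * The error of one step *)

Section Step.
Variables (R : realType) (P : nat -> {poly R}) (m s : nat).
Hypothesis LP : legendre_basis P.

(** The errors of the arguments of [f], indexed as in [vdir]. *)
Definition pair_fun (u ud : 'I_m -> R -> R) (a : 'I_m + 'I_m) : R -> R :=
  match a with inl k => u k | inr k => ud k end.

(** One step, written on [0, 1]: [u] is the error and [ud] the delayed error, [gh] is
    the right-hand side along the exact solution, [G] the difference of [gh] and the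
    right-hand side along the scheme, [F] the partial derivatives of the right-hand
    side along the solution.  The delayed error is assumed to satisfy the pointwise
    and the graded bounds that are to be proved for [u]. *)
Record step_error (A B h eta : R) (u ud gh G : 'I_m -> R -> R)
    (F : 'I_m -> 'I_m + 'I_m -> R -> R) : Prop := StepError {
  se_h : 0 < h <= 1;
  se_eta : 0 <= eta <= 1;
  se_cu : forall k, c01 (u k);
  se_cud : forall k, c01 (ud k);
  se_cgh : forall k, c01 (gh k);
  se_cG : forall k, c01 (G k);
  se_cF : forall k a, c01 (F k a);
  se_der : forall k (x : R), 0 < x < 1 ->
    is_derive x 1 (u k) (h * (gh k x - legendre_proj P s (fun z => gh k z - G k z) x));
  se_gh : forall k, expands s h A (gh k);
  se_F : forall k a, expands s h A (F k a);
  se_quad : forall k (x w : R), 0 <= x <= 1 ->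
    (forall a, `|pair_fun u ud a x| <= w) ->
    `|G k x - \sum_a F k a x * pair_fun u ud a x| <= A * w ^+ 2;
  se_u : forall k (x : R), 0 <= x <= 1 -> `|u k x| <= A;
  se_u0 : forall k, `|u k 0| <= eta;
  se_ud : forall k (x : R), 0 <= x <= 1 -> `|ud k x| <= B * h ^+ s.+1;
  se_mud : forall k l, (l < s)%N -> h ^+ l * `|moment l (ud k)| <= B * h ^+ (2 * s) }.

Arguments se_cu {A B h eta u ud gh G F} _ k.
Arguments se_cud {A B h eta u ud gh G F} _ k.
Arguments se_cgh {A B h eta u ud gh G F} _ k.
Arguments se_cG {A B h eta u ud gh G F} _ k.
Arguments se_cF {A B h eta u ud gh G F} _ k a.

Section Estimates.
Variables (A B h eta : R) (u ud gh G : 'I_m -> R -> R).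
Variables (F : 'I_m -> 'I_m + 'I_m -> R -> R).
Hypothesis (A0 : 0 <= A) (B0 : 0 <= B) (H : step_error A B h eta u ud gh G F).

Definition lin_cst : R := (m + m)%:R * (s.+1%:R * A) + A.

Let h0 : 0 < h. Proof. by case/andP: (se_h H). Qed.
Let h1 : h <= 1. Proof. by case/andP: (se_h H). Qed.
Let hn n : 0 <= h ^+ n. Proof. exact/exprn_ge0/ltW. Qed.
Let hn1 n : h ^+ n <= 1. Proof. by apply: exprn_ile1 => //; exact: ltW. Qed.
Let eta0 : 0 <= eta. Proof. by case/andP: (se_eta H). Qed.
Let eta1 : eta <= 1. Proof. by case/andP: (se_eta H). Qed.

Let c01_pair a : c01 (pair_fun u ud a).
Proof. by case: a => k; [exact: se_cu H k|exact: se_cud H k]. Qed.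

Let c01_lin k : c01 (fun x => \sum_a F k a x * pair_fun u ud a x).
Proof. by apply: c01_sum => a; apply: c01M => //; exact: se_cF H k a. Qed.

Lemma sum_cst_ord (c : R) : \sum_(a : 'I_m + 'I_m) c = (m + m)%:R * c.
Proof. by rewrite sumr_const card_sum card_ord mulr_natl. Qed.

Lemma G_le k (w : R) : 0 <= w ->
  (forall a (x : R), 0 <= x <= 1 -> `|pair_fun u ud a x| <= w) ->
  forall x : R, 0 <= x <= 1 ->
  `|G k x| <= (m + m)%:R * (s.+1%:R * A) * w + A * w ^+ 2.
Proof.
move=> w0 uw x x01.
have -> : G k x = \sum_a F k a x * pair_fun u ud a x +
    (G k x - \sum_a F k a x * pair_fun u ud a x) by ring.
apply: le_trans (ler_normD _ _) _; apply: lerD; last first.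
  by apply: (se_quad H k x01) => a; exact: uw.
apply: le_trans (ler_norm_sum _ _ _) _.
rewrite -mulrA -sum_cst_ord; apply: ler_sum => a _.
rewrite normrM; apply: ler_pM => //; last exact: uw.
by have := expands_le (se_F H k a) (se_h H) A0 x01; rewrite natr1.
Qed.

(** [G] is linear in the errors up to a square, which is already small enough;
    the linear part is a sum of products covered by [moment_expands]. *)
Lemma moment_G k i (w E : R) :
  (forall a (x : R), 0 <= x <= 1 -> `|pair_fun u ud a x| <= w) ->
  h ^+ s * w <= E -> w ^+ 2 <= E ->
  (forall a l, (i <= l < s)%N -> h ^+ l * `|moment l (pair_fun u ud a)| <= E) ->
  h ^+ i * `|moment i (G k)| <= lin_cst * E.
Proof.
move=> uw wE w2E mE.
pose rem x := G k x - \sum_a F k a x * pair_fun u ud a x.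
have cr : c01 rem by apply: c01B; [exact: se_cG H k|exact: c01_lin].
have -> : G k = (fun x => \sum_a F k a x * pair_fun u ud a x + rem x).
  by apply/funext => x; rewrite /rem; ring.
rewrite momentD // moment_sum; last by move=> a; apply: c01M => //; exact: se_cF H k a.
rewrite /lin_cst mulrDl; apply: le_trans (ler_wpM2l (hn i) (ler_normD _ _)) _.
rewrite mulrDr; apply: lerD.
  apply: le_trans (ler_wpM2l (hn i) (ler_norm_sum _ _ _)) _.
  rewrite mulr_sumr -mulrA -sum_cst_ord; apply: ler_sum => a _; rewrite -mulrA.
  apply: (moment_expands (w := w) (se_h H)) => //.
  - exact: se_cF H k a.
  - exact: se_F H k a.
  - exact: uw.
  - exact: mE.
have E0 : 0 <= E by apply: le_trans w2E; exact: sqr_ge0.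
have rE : `|moment i rem| <= A * E.
  apply: moment_le => // x x01; apply: le_trans (ler_wpM2l A0 w2E).
  by apply: (se_quad H k x01) => a; exact: uw.
by rewrite -[A * E]mul1r; apply: ler_pM.
Qed.

Let u' k x := h * (gh k x - legendre_proj P s (fun z => gh k z - G k z) x).

Let c01_u' k : c01 (u' k).
Proof. by apply: c01Z; apply: c01B; [exact: se_cgh H k|exact: c01_proj]. Qed.

Let c01_g k : c01 (fun z => gh k z - G k z).
Proof. by apply: c01B; [exact: se_cgh H k|exact: se_cG H k]. Qed.

Arguments c01_u' : clear implicits.
Arguments c01_g : clear implicits.

(** Moments of order less than [s] do not see the projection, and what remains of
    [gh - (gh - G)] is [G]. *)
Lemma moment_derivative k i : (i < s)%N -> moment i (u' k) = h * moment i (G k).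
Proof.
move=> is_; have cgh := se_cgh H k; have cG := se_cG H k.
rewrite /u' momentZ; last by apply: c01B => //; exact: c01_proj.
rewrite momentB //; last exact: c01_proj.
by rewrite moment_proj // momentB // opprB addrC subrK.
Qed.

Lemma increment_moment k : (0 < s)%N -> u k 1 - u k 0 = h * moment 0 (G k).
Proof.
move=> s0; rewrite -moment_derivative // /moment.
rewrite -(I01_FTC (c01_u' k) (se_cu H k) (se_der H k)).
by apply: I01_ext => x _; rewrite expr0 mul1r.
Qed.

(** One integration by parts replaces a moment of [u] by the next moment of [G]
    with one more factor [h], which is what the graded scale loses from one moment
    to the next. *)
Lemma moment_step k l (E e : R) : (l.+1 < s)%N -> `|u k 0| <= e ->
  h ^+ l.+1 * `|moment l.+1 (G k)| <= E -> h ^+ l * `|moment l (u k)| <= e + E.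
Proof.
move=> ls ue GE.
have := moment_primitive l (se_cu H k) (c01_u' k) (se_der H k).
rewrite moment_derivative // => E1.
have : `|moment l (u k)| <= `|u k 0| + h * `|moment l.+1 (G k)|.
  apply: (@le_trans _ _ `|l.+1%:R * moment l (u k)|).
    by rewrite normrM normr_nat ler_peMl // ler1n.
  by rewrite E1 -{2}(gtr0_norm h0) -normrM; exact: ler_normD.
move=> b; apply: le_trans (ler_wpM2l (hn l) b) _; rewrite mulrDr mulrA -exprSr.
apply: lerD => //; apply: le_trans ue; rewrite -[leRHS]mul1r.
exact: ler_wpM2r.
Qed.

Variables (CP : R).
Hypotheses (CP0 : 0 <= CP)
  (HCP : forall u (M : R), c01 u -> (forall x : R, 0 <= x <= 1 -> `|u x| <= M) ->
    forall x : R, 0 <= x <= 1 -> `|legendre_proj P s u x| <= CP * M).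

(** These constants, and those below, depend neither on [h] nor on the step; this
    is what makes the estimates uniform. *)
Definition G_cst : R := (m + m)%:R * (s.+1%:R * A) + A * (m%:R * A + B).
Definition slope_cst : R := (1 + CP) * A + CP * G_cst.
Definition sup_cst : R := 2 * m%:R + 2 * m%:R * slope_cst + 2 * B.

Let G_cst_ge0 : 0 <= G_cst.
Proof. by rewrite /G_cst addr_ge0 // mulr_ge0 // ?addr_ge0 // mulr_ge0. Qed.
Let slope_cst_ge0 : 0 <= slope_cst.
Proof. by rewrite /slope_cst addr_ge0 // mulr_ge0 // addr_ge0. Qed.

(** At a maximum point of the sum of the absolute values of the [u k], with value
    [w0], integrating the derivative gives
    [w0 <= m eta + O(h^(s+1)) + (h m slope_cst) w0], and the last term is absorbed
    by the left-hand side. *)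
Lemma sup_le : h * (m%:R * slope_cst) <= 1 / 2 ->
  forall a (x : R), 0 <= x <= 1 -> `|pair_fun u ud a x| <= sup_cst * (eta + h ^+ s.+1).
Proof.
move=> hsmall.
pose S x := \sum_k `|u k x|.
have cS : c01 S.
  apply: c01_sum => k x; apply: continuous_comp; first exact: (se_cu H k).
  exact: norm_continuous.
have [x0 x001 Sx0] := EVT_max ler01 cS.
have {}x001 : 0 <= x0 <= 1 by move: x001; rewrite in_itv.
set w0 := S x0 in Sx0.
have uS k (x : R) : 0 <= x <= 1 -> `|u k x| <= w0.
  move=> x01; apply: le_trans (Sx0 x _); last by rewrite in_itv.
  by rewrite /S (bigD1 k) //= lerDl sumr_ge0.
have w00 : 0 <= w0 by apply: sumr_ge0.
have w0A : w0 <= m%:R * A.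
  rewrite mulr_natl -[m in leRHS]card_ord -sumr_const; apply: ler_sum => k _.
  exact: se_u H k x0 x001.
pose w := w0 + B * h ^+ s.+1.
have w_ge0 : 0 <= w by rewrite addr_ge0 // mulr_ge0.
have Bh0 : 0 <= B * h ^+ s.+1 by exact: mulr_ge0.
have uw a (x : R) : 0 <= x <= 1 -> `|pair_fun u ud a x| <= w.
  case: a => k x01.
    by apply: le_trans (uS k x x01) _; rewrite lerDl.
  by apply: le_trans (se_ud H k x01) _; rewrite lerDr.
have Bh : B * h ^+ s.+1 <= B by rewrite -[leRHS]mulr1; exact: ler_wpM2l.
have GK k (x : R) : 0 <= x <= 1 -> `|G k x| <= G_cst * w.
  move=> x01; apply: le_trans (G_le k w_ge0 uw x01) _.
  rewrite /G_cst mulrDl lerD2l expr2 mulrA; apply: ler_wpM2r => //.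
  by apply: ler_wpM2l => //; exact: lerD.
have u'K k (x : R) : 0 <= x <= 1 -> `|u' k x| <= h * (slope_cst * (h ^+ s + w)).
  move=> x01; rewrite /u' normrM (gtr0_norm h0); apply: ler_wpM2l; first exact: ltW.
  rewrite (projB _ _ (se_cgh H k) (se_cG H k)).
  rewrite opprB addrCA addrC; apply: le_trans (ler_normD _ _) _.
  have b1 := expands_residual LP A0 HCP h0 (se_cgh H k) (se_gh H k) x01.
  have b2 := HCP (se_cG H k) (GK k) x01.
  apply: le_trans (lerD b1 b2) _; rewrite /slope_cst -subr_ge0.
  set X := (X in 0 <= X).
  have -> : X = (1 + CP) * A * w + CP * G_cst * h ^+ s by rewrite /X; ring.
  by rewrite addr_ge0 // mulr_ge0 // mulr_ge0 // addr_ge0.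
have uinc k (x : R) : 0 <= x <= 1 -> `|u k x| <= eta + h * (slope_cst * (h ^+ s + w)).
  move=> x01; have [x00 x11] := andP x01.
  have dux (z : R) : z \in `]0, x[ -> is_derive z 1 (u k) (u' k z).
    rewrite in_itv /= => /andP[z0 zx]; apply: (se_der H k).
    by rewrite z0 (lt_le_trans zx).
  have cux : {within `[0, x], continuous (u k)}.
    apply: continuous_subspaceW (se_cu H k) => z.
    by rewrite /= !in_itv /= => /andP[-> /le_trans->].
  have [z zx E] := MVT_segment x00 dux cux.
  have z01 : 0 <= z <= 1.
    by move: zx; rewrite in_itv /= => /andP[-> /le_trans->].
  have -> : u k x = u k 0 + u' k z * x by rewrite -[x in RHS]subr0 -E; ring.
  apply: le_trans (ler_normD _ _) _; apply: lerD; first exact: (se_u0 H k).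
  rewrite normrM (ger0_norm x00) -[leRHS]mulr1; apply: ler_pM => //.
  exact: u'K.
have w0le : w0 <= m%:R * (eta + h * (slope_cst * (h ^+ s + w))).
  rewrite mulr_natl -[m in leRHS]card_ord -sumr_const; apply: ler_sum => k _.
  exact: uinc.
have w0le2 : w0 <= 2 * m%:R * eta + (2 * m%:R * slope_cst + B) * h ^+ s.+1.
  have : (h * (m%:R * slope_cst)) * w <= 1 / 2 * w by exact: ler_wpM2r.
  have E : m%:R * (eta + h * (slope_cst * (h ^+ s + w))) =
     m%:R * eta + m%:R * slope_cst * h ^+ s.+1 + (h * (m%:R * slope_cst)) * w.
    by rewrite exprS; ring.
  move: w0le; rewrite E /w; lra.
move=> a x x01; apply: le_trans (uw a x x01) _; rewrite /sup_cst -subr_ge0 /w.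
have m0 : 0 <= m%:R :> R by exact: ler0n.
have t1 : 0 <= (2 * m%:R * slope_cst + 2 * B) * eta.
  by rewrite mulr_ge0 // addr_ge0 // !mulr_ge0.
have t2 : 0 <= 2 * m%:R * h ^+ s.+1 by rewrite !mulr_ge0.
move: w0le2 t1 t2; lra.
Qed.

Definition moment_cst0 : R := sup_cst + 3 * sup_cst ^+ 2 + B.
Definition moment_cst j : R := iter j (fun e => 1 + (1 + lin_cst) * e) moment_cst0.

Let sup_cst_ge0 : 0 <= sup_cst.
Proof. by rewrite /sup_cst !addr_ge0 ?mulr_ge0 ?mulr_ge0. Qed.
Let moment_cst0_ge0 : 0 <= moment_cst0.
Proof. by rewrite /moment_cst0 !addr_ge0 ?mulr_ge0 ?sqr_ge0. Qed.
Let lin_cst_ge0 : 0 <= lin_cst.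
Proof. by rewrite /lin_cst addr_ge0 ?mulr_ge0. Qed.

Let moment_cst_ge0 j : 0 <= moment_cst j.
Proof.
by elim: j => [//|j IH]; rewrite /moment_cst iterS addr_ge0 // mulr_ge0 // addr_ge0.
Qed.

Let moment_cstS j : moment_cst j.+1 = 1 + moment_cst j + lin_cst * moment_cst j.
Proof. by rewrite /moment_cst iterS -/(moment_cst j); ring. Qed.

Let moment_cst_ge j : moment_cst0 <= moment_cst j.
Proof.
elim: j => [//|j IH]; rewrite moment_cstS; have := mulr_ge0 lin_cst_ge0 (moment_cst_ge0 j); lra.
Qed.

Let Theta := eta + h ^+ (2 * s).

Let Theta_ge0 : 0 <= Theta. Proof. by rewrite addr_ge0. Qed.

Let w := sup_cst * (eta + h ^+ s.+1).

Let w_ge0 : 0 <= w. Proof. by rewrite mulr_ge0 // addr_ge0. Qed.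

Let hpow i j : (i <= j)%N -> h ^+ j <= h ^+ i.
Proof. by move=> ij; apply: ler_wiXn2l => //; exact: ltW. Qed.

Let hw_le j : (0 < s)%N -> (s.-1 <= j)%N -> h ^+ j * w <= moment_cst0 * Theta.
Proof.
move=> s0 sj; apply: (@le_trans _ _ (sup_cst * Theta)).
  rewrite /w mulrCA; apply: ler_wpM2l => //; rewrite mulrDr -exprD; apply: lerD.
    by rewrite -[leRHS]mul1r; apply: ler_wpM2r.
  by apply: hpow; rewrite mul2n -addnn -addSnnS leq_add2r -(prednK s0) ltnS.
apply: ler_wpM2r => //; rewrite /moment_cst0; have := sqr_ge0 sup_cst; move: B0; lra.
Qed.

Let w2_le : (0 < s)%N -> w ^+ 2 <= moment_cst0 * Theta.
Proof.
move=> s0; apply: (@le_trans _ _ (3 * sup_cst ^+ 2 * Theta)); last first.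
  by apply: ler_wpM2r => //; rewrite /moment_cst0; move: sup_cst_ge0 B0; lra.
rewrite /w exprMn [3 * _ in leRHS]mulrC -[leRHS]mulrA.
apply: ler_wpM2l; first exact: sqr_ge0.
have a1 : eta * eta <= eta by exact: ler_piMr.
have a2 : eta * h ^+ s.+1 <= eta by exact: ler_piMr.
have a3 : h ^+ s.+1 * h ^+ s.+1 <= h ^+ (2 * s).
  by rewrite -exprD; apply: hpow; rewrite mul2n -addnn leq_add.
have := hn (2 * s); rewrite /Theta; move: a1 a2 a3; rewrite sqrrD !expr2; lra.
Qed.

Hypothesis (s0 : (0 < s)%N) (hsmall : h * (m%:R * slope_cst) <= 1 / 2).

(** Descending induction from [l = s - 1], where the sup bound is enough; the moment
    of order [l] is bounded by moments of larger order only, so there is nothing to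
    absorb. *)
Lemma moment_le_cst j k l : (s <= l + j.+1)%N -> (l < s)%N ->
  h ^+ l * `|moment l (u k)| <= moment_cst j * Theta.
Proof.
have uw := sup_le hsmall.
have base l' k' : (s.-1 <= l')%N -> h ^+ l' * `|moment l' (u k')| <= moment_cst0 * Theta.
  move=> sl; apply: le_trans (hw_le s0 sl); apply: ler_wpM2l => //.
  by apply: moment_le (se_cu H k') _ => x x01; exact: (uw (inl k')).
have up j' : moment_cst0 * Theta <= moment_cst j' * Theta by exact: ler_wpM2r.
elim: j k l => [|j IH] k l slj ls.
  by apply: base; rewrite -subn1 leq_subLR addnC.
have [sl|ls1] := leqP s l.+1.
  by apply: le_trans (up _); apply: base; rewrite -subn1 leq_subLR add1n.
have wE : h ^+ s * w <= moment_cst j * Theta.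
  by apply: le_trans (up _); apply: hw_le => //; exact: leq_pred.
have w2E : w ^+ 2 <= moment_cst j * Theta by apply: le_trans (up _); exact: w2_le.
have mG : h ^+ l.+1 * `|moment l.+1 (G k)| <= lin_cst * (moment_cst j * Theta).
  apply: (moment_G k uw wE w2E) => -[k'|k'] l' /andP[ll' l's] /=.
    by apply: IH => //; rewrite (leq_trans slj) // -addSnnS leq_add2r.
  apply: le_trans (se_mud H k' l's) _; apply: le_trans (up _).
  apply: ler_pM => //; last by rewrite lerDr.
  by rewrite /moment_cst0; have := sqr_ge0 sup_cst; move: sup_cst_ge0; lra.
apply: le_trans (moment_step ls1 (se_u0 H k) mG) _.
rewrite moment_cstS.
have -> : (1 + moment_cst j + lin_cst * moment_cst j) * Theta =
    Theta + moment_cst j * Theta + lin_cst * (moment_cst j * Theta) by ring.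
apply: lerD => //.
have := mulr_ge0 (moment_cst_ge0 j) Theta_ge0; have := hn (2 * s).
rewrite /Theta; lra.
Qed.

Lemma increment_le k : `|u k 1 - u k 0| <= h * (lin_cst * moment_cst s * Theta).
Proof.
have uw := sup_le hsmall; have up : moment_cst0 * Theta <= moment_cst s * Theta by exact: ler_wpM2r.
rewrite increment_moment // normrM (gtr0_norm h0); apply: ler_wpM2l; first exact: ltW.
rewrite -[`|_|]mul1r -(expr0 h) -mulrA.
have wE : h ^+ s * w <= moment_cst s * Theta.
  by apply: le_trans up; apply: hw_le => //; exact: leq_pred.
have w2E : w ^+ 2 <= moment_cst s * Theta by apply: le_trans up; exact: w2_le.
apply: (moment_G k uw wE w2E) => -[k'|k'] l' /andP[_ l's] /=.
  by apply: moment_le_cst => //; rewrite addnS ltnW // ltnS leq_addl.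
apply: le_trans (se_mud H k' l's) _; apply: le_trans up.
apply: ler_pM => //; last by rewrite lerDr.
by rewrite /moment_cst0; have := sqr_ge0 sup_cst; move: sup_cst_ge0; lra.
Qed.

End Estimates.

(** The increment inherits the bound of the moment of order 0, and not the weaker
    pointwise bound. *)
Lemma step_estimate (A B : R) : (0 < s)%N -> 0 <= A -> 0 <= B ->
  exists C hmax, [/\ 0 <= C, 0 < hmax & forall h eta u ud gh G F,
    h <= hmax -> step_error A B h eta u ud gh G F ->
    [/\ forall k (x : R), 0 <= x <= 1 -> `|u k x| <= C * (eta + h ^+ s.+1),
        forall k l, (l < s)%N -> h ^+ l * `|moment l (u k)| <= C * (eta + h ^+ (2 * s)) &
        forall k, `|u k 1 - u k 0| <= C * h * (eta + h ^+ (2 * s))]].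
Proof.
move=> s0 A0 B0; have [CP CP0 HCP] := proj_le P s.
have G_cst_ge0 : 0 <= G_cst A B.
  by rewrite /G_cst addr_ge0 // mulr_ge0 // ?addr_ge0 // mulr_ge0.
have slope_cst_ge0 : 0 <= slope_cst A B CP.
  by rewrite /slope_cst addr_ge0 // mulr_ge0 // addr_ge0.
have sup_cst_ge0 : 0 <= sup_cst A B CP.
  by rewrite /sup_cst !addr_ge0 ?mulr_ge0 ?mulr_ge0.
have D_ge0 : 0 <= lin_cst A by rewrite /lin_cst addr_ge0 ?mulr_ge0.
have e_ge0 : 0 <= moment_cst A B CP s.
  elim: (s) => [|j IH]; last by rewrite /moment_cst iterS addr_ge0 // mulr_ge0 // addr_ge0.
  by rewrite /moment_cst0 !addr_ge0 ?mulr_ge0 ?sqr_ge0.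
have mK0 : 0 <= m%:R * slope_cst A B CP by exact: mulr_ge0.
have De0 : 0 <= lin_cst A * moment_cst A B CP s by exact: mulr_ge0.
set Cst := sup_cst A B CP + moment_cst A B CP s + lin_cst A * moment_cst A B CP s.
exists Cst, (1 / (2 * (m%:R * slope_cst A B CP + 1))); split.
- by apply: addr_ge0 => //; apply: addr_ge0.
- by rewrite divr_gt0 // mulr_gt0 // ltr_pwDr.
move=> h eta u ud gh G F hh H.
have [h0 h1] := andP (se_h H); have [eta0 eta1] := andP (se_eta H).
have hn n : 0 <= h ^+ n by apply/exprn_ge0/ltW.
have hsmall : h * (m%:R * slope_cst A B CP) <= 1 / 2.
  move: hh; rewrite ler_pdivlMr; last by rewrite mulr_gt0 // ltr_pwDr.
  lra.
split.
- move=> k x x01; have := sup_le A0 B0 H CP0 HCP hsmall (inl k) x01.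
  move=> /le_trans; apply; apply: ler_wpM2r; first by rewrite addr_ge0.
  by rewrite /Cst; lra.
- move=> k l ls; have := moment_le_cst A0 B0 H CP0 HCP s0 hsmall (j := s) k (l := l).
  move=> /(_ _ ls)/le_trans; apply; first by rewrite addnS ltnW // ltnS leq_addl.
  by apply: ler_wpM2r; [rewrite addr_ge0|rewrite /Cst; lra].
- move=> k; have := increment_le A0 B0 H CP0 HCP s0 hsmall k.
  move=> /le_trans; apply; rewrite mulrA [Cst * h]mulrC.
  apply: ler_wpM2r; first by rewrite addr_ge0.
  by apply: ler_wpM2l; [exact: ltW | rewrite /Cst; lra].
Qed.

End Step.

(** * Norms on row vectors *)

Section Norm.
Variables (R : realType) (m : nat) (N : 'rV[R]_m -> R).
Hypothesis HN : is_norm N.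

Lemma coord_le_mxnorm (x : 'rV[R]_m) i : `|x 0 i| <= `|x|.
Proof. by rewrite [leRHS]/Num.Def.normr /= mx_normrE; exact: (le_bigmax _ _ (0, i)). Qed.

Lemma norm_ge0 x : 0 <= N x.
Proof.
have [_ ND NZ] := HN.
have N0 : N 0 = 0 by rewrite -(scale0r x) NZ normr0 mul0r.
have := ND x (-1 *: x); rewrite NZ normrN1 mul1r scaleN1r subrr N0; lra.
Qed.

Lemma norm_le : exists2 C : R, 0 <= C &
  forall (x : 'rV[R]_m) (w : R), 0 <= w -> (forall i, `|x 0 i| <= w) -> N x <= C * w.
Proof.
have [_ ND NZ] := HN.
have N0 : N 0 = 0 by rewrite -(scale0r 0) NZ normr0 mul0r.
exists (\sum_i N (delta_mx 0 i)) => [|x w w0 xw].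
  by apply: sumr_ge0 => i _; exact: norm_ge0.
rewrite {1}(row_sum_delta x) mulr_suml.
apply: (@le_trans _ _ (\sum_i N (x 0 i *: delta_mx 0 i))).
  elim/big_rec2: _ => [|i y1 y2 _ IH]; first by rewrite N0.
  by apply: le_trans (ND _ _) _; rewrite lerD2l.
apply: ler_sum => i _; rewrite NZ mulrC; apply: ler_wpM2l => //.
exact: norm_ge0.
Qed.

Lemma norm_continuous_rV : continuous N.
Proof.
have [_ ND NZ] := HN; have [C C0 NC] := norm_le.
have NB x y : N x - N y <= C * `|x - y|.
  apply: (@le_trans _ _ (N (x - y))).
    by have := ND (x - y) y; rewrite subrK; lra.
  by apply: NC => // i; exact: coord_le_mxnorm.
move=> x; apply/(@cvgrPdist_lt _ _ _ (nbhs x)) => e e0; near=> y.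
have : ball x (e / (C + 1)) y.
  by near: y; apply: nbhsx_ballx; rewrite divr_gt0 // ltr_wpDl.
rewrite -ball_normE /ball_ /=.
rewrite ltr_pdivlMr ?ltr_wpDl // => xye.
apply: (@le_lt_trans _ _ (C * `|x - y|)).
  by rewrite ler_norml lerNl opprB NB /= distrC NB.
by apply: le_lt_trans xye; rewrite mulrDr mulr1 mulrC lerDl.
Unshelve. all: by end_near. Qed.

(** [N] has a positive minimum on the unit sphere of the sup norm, which is
    compact. *)
Lemma coord_le_norm : exists2 C : R, 0 <= C & forall (x : 'rV[R]_m) i, `|x 0 i| <= C * N x.
Proof.
have [Ninj ND NZ] := HN.
pose S := [set x : 'rV[R]_m | `|x| = 1].
have cS : compact S.
  apply: bounded_closed_compact.
    by exists 1; split=> // M M1 x /= ->; exact: ltW.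
  apply: (@closed_comp _ _ (fun x : 'rV[R]_m => `|x|) [set 1]) => [x _|].
    exact: norm_continuous.
  exact: closed_eq.
have [S0|/set0P/negP/negPn/eqP S0] := pselect (S !=set0); last first.
  exists 0 => // x i; rewrite mul0r.
  have [->|x0] := eqVneq x 0; first by rewrite mxE normr0.
  have : S (`|x|^-1 *: x).
    by rewrite /S /= normrZ normfV normr_id mulVf // normr_eq0.
  by rewrite S0.
have cN : {within S, continuous N}.
  by apply: continuous_subspaceT; exact: norm_continuous_rV.
have [c /[1!inE] cS1 cmin] := EVT_min_rV S0 cS cN.
have Nc : 0 < N c.
  rewrite lt_neqAle norm_ge0 andbT eq_sym; apply/eqP => /Ninj c0.
  by move: cS1; rewrite /S /= c0 normr0 => /eqP; rewrite eq_sym oner_eq0.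
exists (N c)^-1 => [|x i]; first by rewrite invr_ge0 norm_ge0.
apply: le_trans (coord_le_mxnorm x i) _.
rewrite mulrC ler_pdivlMr //.
have [->|x0] := eqVneq x 0; first by rewrite normr0 mul0r norm_ge0.
have nx : 0 < `|x| by rewrite normr_gt0.
have -> : N x = `|x| * N (`|x|^-1 *: x).
  by rewrite NZ normfV normr_id mulrA divff ?mul1r // gt_eqF.
apply: ler_wpM2l => //; apply: cmin; rewrite inE /S /=.
by rewrite normrZ normfV normr_id mulVf // normr_eq0.
Qed.

End Norm.

(** * Propagation of the error *)

(** The index of the scheme for the step [i] of the block [j], both counted from 0;
    the indices [n <= 0] are those of block 0. *)
Definition idx (nu j i : nat) : int := (j * nu + i + 1)%:Z - nu%:Z.

Lemma idx_delay nu j i : idx nu j.+1 i - nu%:Z = idx nu j i.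
Proof. by rewrite /idx; lia. Qed.

Lemma idx_pred nu j i : idx nu j.+1 i - 1 = (j * nu + i)%N%:Z.
Proof. by rewrite /idx; lia. Qed.

Lemma idx_succ nu j i : idx nu j.+1 i = (j * nu + i.+1)%N%:Z.
Proof. by rewrite /idx; lia. Qed.

Lemma idxS_ge1 nu j i : 1 <= idx nu j.+1 i.
Proof. by rewrite /idx; lia. Qed.

Lemma idx_le K nu j i : (j < K)%N -> (i < nu)%N -> idx nu j.+1 i <= (K * nu)%N%:Z.
Proof. by rewrite /idx => jK inu; have := leq_mul jK (leqnn nu); lia. Qed.

Lemma idx_surj (K nu : nat) (n : int) : 1 <= n <= (K * nu)%N%:Z ->
  exists j i, [/\ (j < K)%N, (i < nu)%N & n = idx nu j.+1 i].
Proof.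
case: n => [n|n] /andP[]; last by lia.
move=> n1 nK; have nu0 : (0 < nu)%N by case: nu nK => // ; rewrite muln0; lia.
exists ((n.-1) %/ nu)%N, ((n.-1) %% nu)%N; split.
- by rewrite ltn_divLR //; lia.
- by rewrite ltn_mod.
- rewrite idx_succ addnS -divn_eq prednK //; lia.
Qed.

Section ErrorBounds.
Variables (R : realType) (s : nat) (s0 : (0 < s)%N) (m : nat) (N : 'rV[R]_m -> R)
  (P : nat -> {poly R}) (f : 'rV[R]_m * 'rV[R]_m -> 'rV[R]_m)
  (phi y : R -> 'rV[R]_m) (t0 tau T : R) (K : nat) (y0 : 'rV[R]_m) (rho : R).
Hypotheses (HN : is_norm N) (LP : legendre_basis P) (tau0 : 0 < tau)
  (TE : T - t0 = K%:R * tau) (Cf : Ck s.+2 f)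
  (Cphi : Ck_itv s.+2 (t0 - tau) t0 phi) (Hy : dde_solution f phi t0 tau T y0 y).

Local Notation Y := (block phi y t0 tau).

Lemma smooth_blocks j : (j <= K)%N -> exists d, smooth_block s.+1 tau (Y j) d.
Proof.
elim: j => [|j IH] jK; first exact: smooth_block0.
have [d Hd] := IH (ltnW jK).
have [_ H] := smooth_blockS tau0 TE (Ck_pred Cf) Hy jK Hd.
by eexists; exact: H.
Qed.

Definition err (nu : nat) sigma j i (k : 'I_m) (c : R) : R :=
  let h := tau / nu%:R in (Y j (i%:R * h + c * h) - sigma (idx nu j i) (c * h)) 0 k.

(** [bb_end] is the grid error at the end of the block.  It is stated with [ygrid],
    for which block 0 ends with the exact value [y0] even if [phi t0] is
    different. *)
Record block_bounds (B : R) (nu : nat) (sigma : int -> R -> 'rV[R]_m) j : Prop :=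
  BlockBounds {
  bb_sup : forall i k (c : R), (i < nu)%N -> 0 <= c <= 1 ->
    `|err nu sigma j i k c| <= B * (tau / nu%:R) ^+ s.+1;
  bb_moment : forall i k l, (i < nu)%N -> (l < s)%N ->
    (tau / nu%:R) ^+ l * `|moment l (err nu sigma j i k)| <= B * (tau / nu%:R) ^+ (2 * s);
  bb_end : forall k,
    `|(y (t0 + j%:R * tau) - ygrid y0 (tau / nu%:R) sigma (j * nu)%N%:Z) 0 k|
      <= B * (tau / nu%:R) ^+ (2 * s);
  bb_incr : (0 < j)%N -> forall i k, (i < nu)%N ->
    `|err nu sigma j i k 1 - err nu sigma j i k 0| <= B * (tau / nu%:R) ^+ (2 * s + 1) }.

Lemma block_bounds_le (B B' : R) nu sigma j : B <= B' ->
  block_bounds B nu sigma j -> block_bounds B' nu sigma j.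
Proof.
move=> BB [b1 b2 b3 b4].
have hn n : 0 <= (tau / nu%:R) ^+ n by rewrite exprn_ge0 // divr_ge0 // ltW.
split.
- by move=> i k c inu c01; apply: le_trans (b1 i k c inu c01) _; exact: ler_wpM2r.
- by move=> i k l inu ls; apply: le_trans (b2 i k l inu ls) _; exact: ler_wpM2r.
- by move=> k; apply: le_trans (b3 k) _; exact: ler_wpM2r.
- by move=> j0 i k inu; apply: le_trans (b4 j0 i k inu) _; exact: ler_wpM2r.
Qed.

Definition admissible (hmax : R) nu sigma :=
  [/\ (0 < nu)%N, tau / nu%:R <= hmax,
      is_scheme f phi P s t0 (tau / nu%:R) nu K y0 sigma &
      near_branch N rho (tau / nu%:R) nu K y0 sigma].

Lemma block_bounds0 nu sigma (hmax : R) :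
  admissible hmax nu sigma -> block_bounds 0 nu sigma 0.
Proof.
move=> [nu0 _ [Hphi _] _].
have nuR : (nu%:R : R) != 0 by rewrite pnatr_eq0 -lt0n.
have e0 i k (c : R) : (i < nu)%N -> 0 <= c <= 1 -> err nu sigma 0 i k c = 0.
  move=> inu c01; rewrite /err /= Hphi //; last by rewrite /idx; lia.
  rewrite [X in phi X - _](_ : _ = tgrid t0 (tau / nu%:R) (idx nu 0 i - 1) + c * (tau / nu%:R)).
    by rewrite subrr mxE.
  have -> : idx nu 0 i - 1 = i%:Z - nu%:Z by rewrite /idx; lia.
  by rewrite /tgrid intrB !pmulrn mulrBl [nu%:R * _]mulrC divfK //; ring.
split.
- by move=> i k c inu c01; rewrite e0 // normr0 mul0r.
- move=> i k l inu ls; rewrite mul0r.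
  have -> : moment l (err nu sigma 0 i k) = moment l (fun=> 0).
    by apply: I01_ext => x x01; rewrite e0.
  have : `|moment l (fun=> 0 : R)| <= 0.
    by apply: moment_le => [|x _]; [exact: c01_cst|rewrite normr0].
  by rewrite normr_le0 => /eqP->; rewrite normr0 mulr0.
- by have [_ yt0 _ _] := Hy; move=> k; rewrite !mul0r addr0 yt0 /ygrid mul0n eqxx subrr mxE normr0.
- by [].
Qed.

Lemma finite_bound (I : finType) (Q : I -> R -> Prop) :
  (forall i (C D : R), C <= D -> Q i C -> Q i D) ->
  (forall i, exists2 C : R, 0 <= C & Q i C) ->
  exists2 C : R, 0 <= C & forall i, Q i C.
Proof.
move=> Qmono QC.
have /choice[C HC] (i : I) : exists C, 0 <= C /\ Q i C.
  by have [C ? ?] := QC i; exists C.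
exists (\sum_i C i) => [|i]; first by apply: sumr_ge0 => i _; have [] := HC i.
have [_ QCi] := HC i; apply: Qmono QCi.
by rewrite (bigD1 i) //= lerDl sumr_ge0 // => j _; have [] := HC j.
Qed.

Lemma curve_bounded (Z : R -> 'rV[R]_m) : {within `[0, tau], continuous Z} ->
  exists2 M : R, 0 <= M & forall x : R, 0 <= x <= tau -> forall k, `|Z x 0 k| <= M.
Proof.
move=> cZ; have cn : {within `[0, tau], continuous (fun x => `|Z x|)}.
  by move=> x; apply: continuous_comp; [exact: cZ | exact: norm_continuous].
have [c _ cm] := EVT_max (ltW tau0) cn; exists `|Z c| => // x x01 k.
by apply: le_trans (coord_le_mxnorm _ _) _; apply: cm; rewrite in_itv.
Qed.

Lemma expands_weaken k (h C D : R) u : 0 <= h -> C <= D ->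
  expands k h C u -> expands k h D u.
Proof.
move=> h0 CD [p [sp pC up]]; exists p; split=> //.
  by move=> i; apply: le_trans (pC i) CD.
by move=> c c01; apply: le_trans (up c c01) _; apply: ler_wpM2r => //; exact: exprn_ge0.
Qed.

Lemma expands_block j (g : 'rV[R]_m * 'rV[R]_m -> R) : (j < K)%N -> Ck s g ->
  exists2 C : R, 0 <= C & forall x h : R, 0 <= x -> 0 < h <= 1 -> x + h <= tau ->
    expands s h C (fun c => g (Y j.+1 (x + c * h), Y j (x + c * h))).
Proof.
move=> jK Cg; have [d Hd] := smooth_blocks (ltnW jK).
have [H _] := smooth_blockS tau0 TE (Ck_pred Cf) Hy jK Hd.
exact: H (leqnSn s) Cg.
Qed.

Lemma block_continuous j : (j <= K)%N -> {within `[0, tau], continuous (Y j)}.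
Proof. by move=> /smooth_blocks[d []]. Qed.

Lemma grid_ge0 nu i : 0 <= i%:R * (tau / nu%:R).
Proof. by rewrite mulr_ge0 // divr_ge0 // ltW. Qed.

Lemma grid_le nu i : (i < nu)%N -> i%:R * (tau / nu%:R) + tau / nu%:R <= tau.
Proof.
move=> inu; have nu0 : 0 < nu%:R :> R by rewrite ltr0n (leq_ltn_trans _ inu).
rewrite -[X in _ + X]mul1r -mulrDl natr1 mulrA ler_pdivrMr // mulrC.
by apply: ler_wpM2l; [exact: ltW | rewrite ler_nat].
Qed.

Lemma err_start hmax nu sigma j i k : admissible hmax nu sigma -> (j < K)%N ->
  (i < nu)%N -> err nu sigma j.+1 i k 0 =
    (Y j.+1 (i%:R * (tau / nu%:R)) - ygrid y0 (tau / nu%:R) sigma (idx nu j.+1 i - 1)) 0 k.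
Proof.
move=> [_ _ [_ Hs] _] jK inu; rewrite /err !mul0r addr0.
have [|_ -> _] // := Hs (idx nu j.+1 i).
by rewrite idxS_ge1 idx_le.
Qed.

Lemma err_stop nu sigma j i k : err nu sigma j.+1 i k 1 =
  (Y j.+1 (i.+1%:R * (tau / nu%:R)) - ygrid y0 (tau / nu%:R) sigma (idx nu j.+1 i)) 0 k.
Proof.
rewrite /err !mul1r /ygrid.
have -> : (idx nu j.+1 i == 0) = false by case: eqP (idxS_ge1 nu j i) => // ->.
by rewrite -natr1 mulrDl mul1r.
Qed.

Lemma sigma_continuous hmax nu sigma j i : admissible hmax nu sigma -> (j <= K)%N ->
  (i < nu)%N ->
  {within `[0, 1], continuous (fun c : R => sigma (idx nu j i) (c * (tau / nu%:R)))}.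
Proof.
move=> Ad jK inu; have [nu0 _ [Hphi Hs] _] := Ad.
have nuR : 0 < nu%:R :> R by rewrite ltr0n.
have h0 : 0 < tau / nu%:R by rewrite divr_gt0.
case: j jK => [|j] jK.
  have cY : {within `[0, 1], continuous (fun c => Y 0 (i%:R * (tau / nu%:R) + c * (tau / nu%:R)))}.
    exact: within_affine (grid_ge0 nu i) (ltW h0) (grid_le inu) (block_continuous jK).
  apply: subspace_eq_continuous cY => c; rewrite inE /= in_itv /= => c01.
  apply/rowP => k; apply/eqP; rewrite -subr_eq0.
  have [E _ _ _] := block_bounds0 Ad.
  have := E i k c inu c01; rewrite mul0r normr_le0 => /eqP E0.
  by rewrite -[X in _ == X]E0 /err [in X in _ == X]mxE; apply/eqP; rewrite mxE.
apply/subspace_continuousP => c /=; rewrite in_itv /= => c01.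
have [|_ _ ds] := Hs (idx nu j.+1 i); first by rewrite idxS_ge1 idx_le.
have dc : differentiable (sigma (idx nu j.+1 i)) (c * (tau / nu%:R)).
  by apply/derivable1_diffP; case: (ds c c01).
apply: cvg_within_filter.
apply: (@continuous_comp _ _ _ (fun c : R => c * (tau / nu%:R)) (sigma (idx nu j.+1 i))).
  by apply: cvgM; [exact: cvg_id|exact: cvg_cst].
exact: differentiable_continuous.
Qed.

Lemma c01_curve (g : 'rV[R]_m * 'rV[R]_m -> R) (Z1 Z2 : R -> 'rV[R]_m) :
  continuous g -> {within `[0, 1], continuous Z1} -> {within `[0, 1], continuous Z2} ->
  c01 (fun c => g (Z1 c, Z2 c)).
Proof.
move=> cg /subspace_continuousP c1 /subspace_continuousP c2.
have cZ : {within `[0, 1], continuous (fun c => (Z1 c, Z2 c))}.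
  by apply/subspace_continuousP => c cA; exact: cvg_pair (c1 c cA) (c2 c cA).
move=> c; apply: (@continuous_comp _ _ _ ((fun c => (Z1 c, Z2 c)) : subspace _ -> _) g).
  exact: cZ.
exact: cg.
Qed.

Lemma err_derive hmax nu sigma j i k (x : R) : admissible hmax nu sigma ->
  (j < K)%N -> (i < nu)%N -> 0 < x < 1 ->
  let h := tau / nu%:R in
  let g c := f (sigma (idx nu j.+1 i) (c * h), sigma (idx nu j i) (c * h)) 0 k in
  is_derive x 1 (err nu sigma j.+1 i k)
    (h * (f (Y j.+1 (i%:R * h + x * h), Y j (i%:R * h + x * h)) 0 k
          - legendre_proj P s g x)).
Proof.
move=> Ad jK inu x01 h g; have [nu0 _ [_ Hs] _] := Ad.
have h0 : 0 < h by rewrite divr_gt0 // ltr0n.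
have [x0 x1] := andP x01.
have [d Hd] := smooth_blocks (ltnW jK).
have [_ [_ dY _]] := smooth_blockS tau0 TE (Ck_pred Cf) Hy jK Hd.
have ixh : 0 < i%:R * h + x * h < tau.
  have := grid_ge0 nu i; have := grid_le inu; rewrite -/h => ih1 ih0.
  have xh0 : 0 < x * h by exact: mulr_gt0.
  have xh1 : x * h < h by rewrite gtr_pMl.
  by apply/andP; split; lra.
have dY1 := is_derive_affine (dY _ k ixh).
have [|_ _ ds] := Hs (idx nu j.+1 i); first by rewrite idxS_ge1 idx_le.
have x01' : 0 <= x <= 1 by rewrite !ltW.
have ds0 := is_derive_coord k (ds x x01').
rewrite -/h -[X in is_derive X]add0r in ds0.
have ds2 := is_derive_affine ds0.
have -> : err nu sigma j.+1 i k = (fun c => Y j.+1 (i%:R * h + c * h) 0 k)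
    - (fun c => sigma (idx nu j.+1 i) (0 + c * h) 0 k).
  by apply/funext => c; rewrite !fctE /err add0r !mxE.
apply: is_derive_eq; rewrite mulrBr; congr (_ - h * _).
rewrite summxE /legendre_proj; apply: eq_bigr => l _.
by rewrite !mxE idx_delay.
Qed.

(** As the scheme stays near its preceding grid value, and the grid error is at most
    1, exact solution and scheme remain in a fixed box, on which the remainder of
    [f] is uniformly quadratic. *)
Lemma step_error_block j (B : R) : (j < K)%N -> 0 <= B ->
  exists2 A : R, 0 <= A & forall hmax nu sigma i eta,
    admissible hmax nu sigma -> tau / nu%:R <= 1 -> (i < nu)%N ->
    block_bounds B nu sigma j -> 0 <= eta <= 1 ->
    (forall k, `|err nu sigma j.+1 i k 0| <= eta) ->
    exists gh G F, step_error P s A B (tau / nu%:R) eta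
      (err nu sigma j.+1 i) (err nu sigma j i) gh G F.
Proof.
move=> jK B0.
have Cfk k : Ck s.+2 (fun v => f v 0 k) by exact: Ck_coord.
have CDfk k a : Ck s.+1 ('D_(vdir R a) (fun v => f v 0 k)) by have [_] := Cfk k; apply.
have [M1 M10 YM1] := curve_bounded (block_continuous jK).
have [M2 M20 YM2] := curve_bounded (block_continuous (ltnW jK)).
have [cN cN0 NcN] := coord_le_norm HN.
pose rr := M1 + M2 + B + 1 + cN * `|rho|.
have cNr : 0 <= cN * `|rho| by exact: mulr_ge0.
have rr0 : 0 <= rr by rewrite /rr !addr_ge0.
have [A1 A10 HA1] : exists2 C : R, 0 <= C & forall k, forall x h : R,
    0 <= x -> 0 < h <= 1 -> x + h <= tau ->
    expands s h C (fun c => f (Y j.+1 (x + c * h), Y j (x + c * h)) 0 k).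
  apply: finite_bound => [k C D CD H x h x0 h01 xh|k].
    by apply: expands_weaken CD (H x h x0 h01 xh); case/andP: h01 => /ltW.
  exact: expands_block jK (Ck_leq (leqW (leqnSn s)) (Cfk k)).
have [A2 A20 HA2] : exists2 C : R, 0 <= C &
    forall ka : 'I_m * ('I_m + 'I_m), forall x h : R,
    0 <= x -> 0 < h <= 1 -> x + h <= tau ->
    expands s h C (fun c => 'D_(vdir R ka.2) (fun v => f v 0 ka.1)
       (Y j.+1 (x + c * h), Y j (x + c * h))).
  apply: finite_bound => [k C D CD H x h x0 h01 xh|ka].
    by apply: expands_weaken CD (H x h x0 h01 xh); case/andP: h01 => /ltW.
  exact: expands_block jK (Ck_leq (leqnSn s) (CDfk ka.1 ka.2)).
have [Q Q0 HQ] : exists2 C : R, 0 <= C & forall k, forall x z : ('rV[R]_m * 'rV[R]_m)%type,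
    box rr x -> box rr z -> forall w : R, (forall a, `|pcoord x a - pcoord z a| <= w) ->
    `|f x 0 k - f z 0 k - \sum_a (pcoord x a - pcoord z a)
       * 'D_(vdir R a) (fun v => f v 0 k) x| <= C * w ^+ 2.
  apply: finite_bound => [k C D CD H x z bx bz w xz|k].
    by apply: le_trans (H x z bx bz w xz) _; apply: ler_wpM2r => //; exact: sqr_ge0.
  exact: (quadratic_remainder rr (Ck_leq (isT : (2 <= s.+2)%N) (Cfk k))).
exists (A1 + A2 + Q + 2 * rr); first by rewrite !addr_ge0 // mulr_ge0.
move=> hmax nu sigma i eta Ad h1 inu Bj eta01 e0.
have [nu0 _ [Hphi Hs] Hnear] := Ad.
set h := tau / nu%:R in h1 *.
have h0 : 0 < h by rewrite divr_gt0 // ltr0n.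
have ih0 : 0 <= i%:R * h := grid_ge0 nu i.
have ihtau : i%:R * h + h <= tau := grid_le inu.
have h01 : 0 < h <= 1 by rewrite h0.
have ptau (c : R) : 0 <= c <= 1 -> 0 <= i%:R * h + c * h <= tau.
  move=> /andP[c0 c1]; have := mulr_ge0 c0 (ltW h0).
  have : c * h <= h by rewrite ger_pMl.
  by move=> ? ?; apply/andP; split; lra.
have rrE : rr = M1 + M2 + B + 1 + cN * `|rho| by [].
have Y1r (c : R) : 0 <= c <= 1 -> forall k, `|Y j.+1 (i%:R * h + c * h) 0 k| <= rr.
  move=> c01 k; apply: le_trans (YM1 _ (ptau c c01) k) _; rewrite rrE; lra.
have Y2r (c : R) : 0 <= c <= 1 -> forall k, `|Y j (i%:R * h + c * h) 0 k| <= rr.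
  move=> c01 k; apply: le_trans (YM2 _ (ptau c c01) k) _; rewrite rrE; lra.
have S2r (c : R) : 0 <= c <= 1 -> forall k, `|sigma (idx nu j i) (c * h) 0 k| <= rr.
  move=> c01 k.
  have e2 := bb_sup Bj k inu c01.
  have hs1 : h ^+ s.+1 <= 1 by apply: exprn_ile1 => //; exact: ltW.
  have Bh : B * h ^+ s.+1 <= B by rewrite -[leRHS]mulr1; exact: ler_wpM2l.
  have -> : sigma (idx nu j i) (c * h) 0 k =
      Y j (i%:R * h + c * h) 0 k - err nu sigma j i k c.
    by rewrite /err -/h !mxE opprB addrC subrK.
  apply: le_trans (ler_normB _ _) _.
  have := YM2 _ (ptau c c01) k; move: e2; rewrite -/h rrE; lra.
have nK : 1 <= idx nu j.+1 i <= (K * nu)%N%:Z by rewrite idxS_ge1 idx_le.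
(* the scheme is within rho of its preceding grid value, whose error is at most
   eta <= 1 *)
have S1r (c : R) : 0 <= c <= 1 -> forall k, `|sigma (idx nu j.+1 i) (c * h) 0 k| <= rr.
  move=> c01 k.
  have g1 := NcN (sigma (idx nu j.+1 i) (c * h) - ygrid y0 h sigma (idx nu j.+1 i - 1)) k.
  have g2 : cN * N (sigma (idx nu j.+1 i) (c * h) - ygrid y0 h sigma (idx nu j.+1 i - 1))
      <= cN * `|rho|.
    apply: ler_wpM2l => //; apply: le_trans (ler_norm rho).
    exact: Hnear nK c c01.
  have := e0 k; rewrite (err_start k Ad jK inu) -/h.
  have c00 : 0 <= (0 : R) <= 1 by rewrite lexx ler01.
  have := YM1 _ (ptau 0 c00) k; rewrite mul0r addr0.
  move: g1 g2; rewrite !mxE; set a := sigma _ _ _ _; set b := ygrid _ _ _ _ _ _.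
  set Yk := Y _ _ _ _ => g1 g2 g3 g4; have [_ eta1] := andP eta01.
  have -> : a = (a - b) - (Yk - b) + Yk by ring.
  apply: le_trans (ler_normD _ _) _.
  apply: le_trans (lerD (ler_normB _ _) (lexx _)) _; rewrite rrE; lra.
pose gh k c := f (Y j.+1 (i%:R * h + c * h), Y j (i%:R * h + c * h)) 0 k.
pose g k c := f (sigma (idx nu j.+1 i) (c * h), sigma (idx nu j i) (c * h)) 0 k.
pose F k a c := 'D_(vdir R a) (fun v => f v 0 k)
  (Y j.+1 (i%:R * h + c * h), Y j (i%:R * h + c * h)).
exists gh, (fun k c => gh k c - g k c), F.
have cY1 := within_affine ih0 (ltW h0) ihtau (block_continuous jK).
have cY2 := within_affine ih0 (ltW h0) ihtau (block_continuous (ltnW jK)).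
have cS1 := sigma_continuous Ad jK inu; have cS2 := sigma_continuous Ad (ltnW jK) inu.
have cf k : continuous (fun v => f v 0 k) by exact: Ck_continuous (Cfk k).
have cgh k : c01 (gh k) by exact: (c01_curve (cf k) cY1 cY2).
have cg k : c01 (g k) by exact: (c01_curve (cf k) cS1 cS2).
have ccoord (Z : R -> 'rV[R]_m) k : {within `[0, 1], continuous Z} -> c01 (fun c => Z c 0 k).
  move=> cZ; apply: (@c01_curve (fun v => v.1 0 k) Z Z) => // v.
  apply: (@continuous_comp _ _ _ fst (fun M : 'rV[R]_m => M 0 k)).
    exact: cvg_fst.
  exact: coord_continuous.
have cerr j' k : {within `[0, 1], continuous (fun c => Y j' (i%:R * h + c * h))} ->
    {within `[0, 1], continuous (fun c => sigma (idx nu j' i) (c * h))} ->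
    c01 (err nu sigma j' i k).
  move=> c1 c2; have -> : err nu sigma j' i k = (fun c => Y j' (i%:R * h + c * h) 0 k
      - sigma (idx nu j' i) (c * h) 0 k).
    by apply/funext => c; rewrite /err !mxE.
  by apply: c01B; exact: ccoord.
split=> //.
- by move=> k; exact: (cerr j.+1 k cY1 cS1).
- by move=> k; exact: (cerr j k cY2 cS2).
- by move=> k; exact: c01B.
- by move=> k a; exact: (c01_curve (Ck_continuous (CDfk k a)) cY1 cY2).
- move=> k x x01; have := err_derive k Ad jK inu x01; rewrite -/h.
  suff -> : (fun z => gh k z - (gh k z - g k z)) = g k by [].
  by apply/funext => z; ring.
- move=> k; have := HA1 k _ _ ih0 h01 ihtau; apply: expands_weaken; first exact: ltW.
  lra.
- move=> k a; have := HA2 (k, a) _ _ ih0 h01 ihtau.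
  by apply: expands_weaken; [exact: ltW | lra].
- move=> k x w x01 uw.
  have pE a : pair_fun (err nu sigma j.+1 i) (err nu sigma j i) a x =
     pcoord (Y j.+1 (i%:R * h + x * h), Y j (i%:R * h + x * h)) a -
     pcoord (sigma (idx nu j.+1 i) (x * h), sigma (idx nu j i) (x * h)) a.
    by case: a => l; rewrite /= /err -/h !mxE.
  have b1 : box rr (Y j.+1 (i%:R * h + x * h), Y j (i%:R * h + x * h)).
    by case=> l /=; [exact: Y1r|exact: Y2r].
  have b2 : box rr (sigma (idx nu j.+1 i) (x * h), sigma (idx nu j i) (x * h)).
    by case=> l /=; [exact: S1r|exact: S2r].
  have w0 : 0 <= w ^+ 2 by exact: sqr_ge0.
  apply: (@le_trans _ _ (Q * w ^+ 2)); last by apply: ler_wpM2r => //; lra.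
  under eq_bigr do rewrite pE mulrC.
  by apply: HQ => // a; rewrite -pE.
- move=> k x x01; rewrite /err -/h !mxE; apply: le_trans (ler_normB _ _) _.
  have := Y1r x x01 k; have := S1r x x01 k; lra.
- move=> k x x01.
  exact: (bb_sup Bj k inu x01).
- by move=> k l ls; exact: (bb_moment Bj k inu ls).
Qed.

(** Discrete Gronwall inequality: the recursion
    [eta (i+1) = eta i + C h (eta i + h^(2s))] has the solution
    [(1 + C h)^i (B + 1) h^(2s) - h^(2s)], which over the block stays below
    [exp (C tau) (B + 1) h^(2s)], and below 1 for small [h]. *)
Lemma block_boundsS j (B hmax : R) : (j < K)%N -> 0 <= B -> 0 < hmax ->
  (forall nu sigma, admissible hmax nu sigma -> block_bounds B nu sigma j) ->
  exists B' hmax', [/\ 0 <= B', 0 < hmax' &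
    forall nu sigma, admissible hmax' nu sigma -> block_bounds B' nu sigma j.+1].
Proof.
move=> jK B0 hmax0 IH.
have [A A0 HA] := step_error_block jK B0.
have [C [h1 [C0 h10 Hstep]]] := step_estimate m LP s0 A0 B0.
pose L := expR (C * tau) * (B + 1).
have L0 : 0 <= L by rewrite mulr_ge0 ?expR_ge0 // addr_ge0.
have CL0 : 0 <= C * (L + 1) by rewrite mulr_ge0 // addr_ge0.
exists (C * (L + 1) + L), (Num.min (Num.min hmax h1) (Num.min 1 (L + 1)^-1)).
split; first by rewrite addr_ge0.
  by rewrite !lt_min hmax0 h10 ltr01 invr_gt0 ltr_wpDl.
move=> nu sigma [nu0]; rewrite !le_min => /andP[/andP[hm hh1] /andP[hle1 hL]] Hs Hn.
have Ad : admissible hmax nu sigma by [].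
have Bj := IH nu sigma Ad.
set h := tau / nu%:R in hm hh1 hle1 hL Hs Hn.
have nuR : 0 < nu%:R :> R by rewrite ltr0n.
have h0 : 0 < h by rewrite divr_gt0.
have nuh : nu%:R * h = tau by rewrite mulrC divfK // gt_eqF.
have hn n : 0 <= h ^+ n by apply/exprn_ge0/ltW.
have hpow a b : (a <= b)%N -> h ^+ b <= h ^+ a.
  by move=> ab; apply: ler_wiXn2l => //; exact: ltW.
pose q := 1 + C * h.
have q1 : 1 <= q by rewrite lerDl mulr_ge0 // ltW.
have q0 : 0 <= q by exact: le_trans q1.
(* q is the growth factor of the error in one step; over a block of nu = tau / h
   steps it accumulates to at most exp (C tau) *)
have qL i : (i <= nu)%N -> q ^+ i * (B + 1) <= L.
  move=> inu; apply: ler_wpM2r; first exact: addr_ge0.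
  apply: (@le_trans _ _ (q ^+ nu)); first exact: ler_weXn2l.
  have -> : C * tau = nu%:R * (C * h) by rewrite mulrCA nuh.
  by rewrite expRM_natl lerXn2r ?nnegrE ?expR_ge0 // expR_ge1Dx.
pose eta i := q ^+ i * (B + 1) * h ^+ (2 * s) - h ^+ (2 * s).
have eta_ge0 i : 0 <= eta i.
  rewrite subr_ge0 ler_peMl //; apply: (@le_trans _ _ (q ^+ i * 1)).
    by rewrite mulr1 exprn_ege1.
  by apply: ler_wpM2l; [exact: exprn_ge0 | rewrite lerDr].
have etaL i : (i <= nu)%N -> eta i <= L * h ^+ (2 * s).
  move=> inu; apply: (@le_trans _ _ (q ^+ i * (B + 1) * h ^+ (2 * s))).
    by rewrite lerBlDr lerDl.
  by apply: ler_wpM2r => //; exact: qL.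
have s2 : (1 <= 2 * s)%N by rewrite muln_gt0.
have s2' : (s.+1 <= 2 * s)%N by rewrite mul2n -addnn -add1n leq_add2r.
have eta_le1 i : (i <= nu)%N -> eta i <= 1.
  move=> inu; apply: le_trans (etaL i inu) _.
  apply: (@le_trans _ _ (L * h)); first by apply: ler_wpM2l => //; have := hpow _ _ s2.
  apply: (@le_trans _ _ ((L + 1) * h)); first by apply: ler_wpM2r; [exact: ltW|rewrite lerDl].
  by rewrite mulrC -ler_pdivlMr ?ltr_wpDl // div1r.
have etaS i : eta i.+1 = eta i + C * h * (eta i + h ^+ (2 * s)).
  by rewrite /eta exprS /q; ring.
have step i : (i < nu)%N -> (forall k, `|err nu sigma j.+1 i k 0| <= eta i) ->
    [/\ forall k (x : R), 0 <= x <= 1 ->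
          `|err nu sigma j.+1 i k x| <= C * (eta i + h ^+ s.+1),
        forall k l, (l < s)%N ->
          h ^+ l * `|moment l (err nu sigma j.+1 i k)| <= C * (eta i + h ^+ (2 * s)) &
        forall k, `|err nu sigma j.+1 i k 1 - err nu sigma j.+1 i k 0|
          <= C * h * (eta i + h ^+ (2 * s))].
  move=> inu e0.
  have eta01 : 0 <= eta i <= 1 by rewrite eta_ge0 eta_le1 // ltnW.
  have [gh [G [F HF]]] := HA _ nu sigma i (eta i) Ad hle1 inu Bj eta01 e0.
  exact: Hstep hh1 HF.
pose E i := Y j.+1 (i%:R * h) - ygrid y0 h sigma ((j * nu + i)%N%:Z).
have errE0 i k : (i < nu)%N -> err nu sigma j.+1 i k 0 = E i 0 k.
  by move=> inu; rewrite (err_start k Ad jK inu) idx_pred.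
have errE1 i k : err nu sigma j.+1 i k 1 = E i.+1 0 k.
  by rewrite err_stop idx_succ.
have EB i : (i <= nu)%N -> forall k, `|E i 0 k| <= eta i.
  elim: i => [|i IHi] inu k.
    have := bb_end Bj k; rewrite /E mul0r /= !addr0 addn0 -/h => b.
    by apply: le_trans b _; rewrite /eta expr0 mul1r mulrDl mul1r addrK.
  have e0 k' : `|err nu sigma j.+1 i k' 0| <= eta i.
    by rewrite errE0 //; apply: IHi; exact: ltnW.
  have [_ _ /(_ k)] := step i inu e0.
  rewrite errE1 errE0 // etaS => b.
  have -> : E i.+1 0 k = E i 0 k + (E i.+1 0 k - E i 0 k) by ring.
  by apply: le_trans (ler_normD _ _) _; apply: lerD => //; apply: IHi; exact: ltnW.
have stepi i (inu : (i < nu)%N) : forall k, `|err nu sigma j.+1 i k 0| <= eta i.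
  by move=> k; rewrite errE0 //; apply: EB; exact: ltnW.
have eta2 i : (i < nu)%N -> eta i + h ^+ (2 * s) <= (L + 1) * h ^+ (2 * s).
  by move=> inu; rewrite mulrDl mul1r lerD2r; apply: etaL; exact: ltnW.
have eta3 i : (i < nu)%N -> eta i + h ^+ s.+1 <= (L + 1) * h ^+ s.+1.
  move=> inu; rewrite mulrDl mul1r lerD2r.
  apply: le_trans (etaL i (ltnW inu)) _; apply: ler_wpM2l => //.
  exact: hpow.
have fin n : C * ((L + 1) * h ^+ n) <= (C * (L + 1) + L) * h ^+ n.
  by rewrite mulrA; apply: ler_wpM2r => //; rewrite lerDl.
split; rewrite -/h.
- move=> i k c inu c01; have [b _ _] := step i inu (stepi i inu).
  apply: le_trans (b k c c01) _; apply: le_trans (fin _).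
  by apply: ler_wpM2l => //; exact: eta3.
- move=> i k l inu ls; have [_ b _] := step i inu (stepi i inu).
  apply: le_trans (b k l ls) _; apply: le_trans (fin _).
  by apply: ler_wpM2l => //; exact: eta2.
- move=> k; have := EB nu (leqnn nu) k.
  rewrite /E nuh /= -natr1 mulrDl mul1r addrA mulSnr => b.
  apply: le_trans b _; apply: le_trans (etaL nu (leqnn nu)) _.
  by apply: ler_wpM2r => //; rewrite lerDr.
- move=> _ i k inu; have [_ _ b] := step i inu (stepi i inu).
  apply: le_trans (b k) _; apply: le_trans (fin _).
  rewrite addn1 exprS -mulrA; apply: ler_wpM2l => //.
  rewrite [leRHS]mulrCA; apply: ler_wpM2l; first exact: ltW.
  exact: eta2.
Qed.

(** The constants change from one block to the next, but the number of blocks does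
    not depend on the step size. *)
Lemma all_block_bounds J : (J <= K)%N -> exists B hmax, [/\ 0 <= B, 0 < hmax &
  forall nu sigma j, (j <= J)%N -> admissible hmax nu sigma -> block_bounds B nu sigma j].
Proof.
elim: J => [|J IH] JK.
  exists 0, 1; split=> // nu sigma j; rewrite leqn0 => /eqP-> Ad.
  exact: block_bounds0 Ad.
have [B [hm [B0 hm0 HB]]] := IH (ltnW JK).
have [B' [hm' [B'0 hm'0 HB']]] :=
  block_boundsS JK B0 hm0 (fun nu sigma => HB nu sigma J (leqnn J)).
exists (B + B'), (Num.min hm hm'); split; first exact: addr_ge0.
  by rewrite lt_min hm0.
move=> nu sigma j jJ [nu0]; rewrite le_min => /andP[h1 h2] Hs Hn.
move: jJ; rewrite leq_eqVlt ltnS => /predU1P[->|jJ].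
  by apply: (@block_bounds_le B'); [rewrite lerDr | apply: HB'].
by apply: (@block_bounds_le B); [rewrite lerDl | apply: HB].
Qed.

End ErrorBounds.

Unset Implicit Arguments.

Theorem theorem18 (R : realType) (s : nat) (s_ge1 : (1 <= s)%N) :
  exists r : nat,
  forall (m : nat) (N : 'rV[R]_m -> R) (P : nat -> {poly R})
    (f : 'rV[R]_m * 'rV[R]_m -> 'rV[R]_m) (phi y : R -> 'rV[R]_m)
    (t0 tau T : R) (K : nat) (y0 : 'rV[R]_m) (rho : R),
  is_norm N -> legendre_basis P ->
  0 < tau -> T - t0 = K%:R * tau ->
  Ck r f -> Ck_itv r (t0 - tau) t0 phi ->
  dde_solution f phi t0 tau T y0 y ->
  0 < rho ->
  exists C : R, \forall nu \near \oo,
    let h := tau / nu%:R in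
    forall sigma : int -> R -> 'rV[R]_m,
    is_scheme f phi P s t0 h nu K y0 sigma ->
    near_branch N rho h nu K y0 sigma ->
    forall n : int, 1 <= n <= (K * nu)%N%:Z ->
      N ((y (tgrid t0 h n) - ygrid y0 h sigma n)
         - (y (tgrid t0 h (n - 1)) - ygrid y0 h sigma (n - 1)))
        <= C * h ^+ (2 * s + 1) /\
      exists2 M : R,
        is_max [set N (delta_sigma y t0 h sigma n (c * h))
                 | c in `[0, 1]%classic] M
        & M <= C * h ^+ (s + 1).
Proof.
(* class C^s is needed for the partial derivatives of f, and C^2 for its quadratic
   remainder *)
exists s.+2 => m N P f phi y t0 tau T K y0 rho HN LP tau0 TE Cf Cphi Hy _.
have [B [hm [B0 hm0 HB]]] := all_block_bounds s_ge1 rho HN LP tau0 TE Cf Cphi Hy (leqnn K).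
have [CN CN0 NC] := norm_le HN.
exists (CN * B); near=> nu => sigma Hs Hn n nK.
set h := tau / nu%:R in Hs Hn *.
have nu0 : (0 < nu)%N by near: nu; exact: nbhs_infty_gt.
have nuR : 0 < nu%:R :> R by rewrite ltr0n.
have hhm : h <= hm.
  rewrite /h ler_pdivrMr // mulrC -ler_pdivrMr //.
  by near: nu; exact: nbhs_infty_ger.
have h0 : 0 < h by rewrite divr_gt0.
have nuh : nu%:R * h = tau by rewrite mulrC divfK // gt_eqF.
have Ad : admissible s N P f phi t0 tau K y0 rho hm nu sigma by [].
have [j [i [jK inu nE]]] := idx_surj nK.
have Bj := HB nu sigma j.+1 jK Ad.
have yE (c : R) : y (tgrid t0 h (n - 1) + c) = block phi y t0 tau j.+1 (i%:R * h + c).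
  rewrite nE idx_pred /tgrid /= -pmulrn natrD natrM -nuh.
  by congr y; ring.
have yE1 : y (tgrid t0 h n) = block phi y t0 tau j.+1 (i.+1%:R * h).
  by rewrite nE idx_succ /tgrid /= -pmulrn natrD natrM -nuh; congr y; ring.
have dE (c : R) k : delta_sigma y t0 h sigma n (c * h) 0 k = err phi y t0 tau nu sigma j.+1 i k c.
  by rewrite /delta_sigma yE /err -nE.
split.
  rewrite -mulrA; apply: NC => [|k]; first by rewrite mulr_ge0 // exprn_ge0 // ltW.
  have := bb_incr Bj (ltn0Sn j) k inu.
  rewrite (err_stop phi y t0 tau y0) (err_start y k Ad jK inu) -/h -nE -yE1.
  by have := yE 0; rewrite !addr0 => <-; rewrite !mxE.
have cd : {within `[0, 1], continuous (fun c : R => delta_sigma y t0 h sigma n (c * h))}.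
  have -> : (fun c : R => delta_sigma y t0 h sigma n (c * h)) = (fun c =>
      block phi y t0 tau j.+1 (i%:R * h + c * h) - sigma (idx nu j.+1 i) (c * h)).
    by apply/funext => c; rewrite /delta_sigma yE nE.
  have c1 := within_affine (grid_ge0 tau0 nu i) (ltW h0) (grid_le tau0 inu)
    (block_continuous tau0 TE Cf Cphi Hy jK).
  have c2 := sigma_continuous s_ge1 tau0 TE Cf Cphi Hy Ad jK inu.
  exact: within_continuousB c1 c2.
have cN : {within `[0, 1], continuous (fun c : R => N (delta_sigma y t0 h sigma n (c * h)))}.
  move=> c; apply: (@continuous_comp _ _ _
    ((fun c : R => delta_sigma y t0 h sigma n (c * h)) : subspace _ -> _) N).
    exact: cd.
  exact: norm_continuous_rV.
have [c c01 cmax] := EVT_max ler01 cN.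
exists (N (delta_sigma y t0 h sigma n (c * h))).
  split; first by exists c.
  by move=> _ [z /= z01 <-]; apply: cmax.
rewrite -mulrA addn1; apply: NC => [|k]; first by rewrite mulr_ge0 // exprn_ge0 // ltW.
rewrite dE; apply: (bb_sup Bj k inu).
by move: c01; rewrite in_itv.
Unshelve. all: by end_near. Qed.
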